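(* Let $V_{\rm per}\colon\mathbb R\to\mathbb R$ be a continuous $1$-periodic function, and let $W\colon\mathbb R\to\mathbb R$ be a Borel function such that $$W\ge 0\quad\text{and}\quad \lim_{R\to+\infty}\frac1R\int_{-R}^R W(s)\,ds=0.$$ For $\varepsilon\in(0,1)$ and $u\in H^1(0,1)$ define $$F_\varepsilon(u)=\int_0^1\Big(|u'(t)|^2+V_{\rm per}\Big(\frac{u(t)}\varepsilon\Big)\Big)dt,\qquad G_\varepsilon(u)=\int_0^1\Big(|u'(t)|^2+V_{\rm per}\Big(\frac{u(t)}\varepsilon\Big)+W\Big(\frac{u(t)}\varepsilon\Big)\Big)dt.$$ Then $$\Gamma\text{-}\lim_{\varepsilon\to0}G_\varepsilon=\Gamma\text{-}\lim_{\varepsilon\to0}F_\varepsilon .$$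
   Context: $\Gamma$-limits are computed on $H^1(0,1)$ (real-valued functions) with respect to the weak topology of $H^1(0,1)$ (equivalently, the strong topology of $L^2(0,1)$). That is, $\Gamma\text{-}\lim_{\varepsilon\to0}E_\varepsilon=E$ means: (liminf) for every $u$ and every $u_\varepsilon\rightharpoonup u$ weakly in $H^1(0,1)$ one has $E(u)\le\liminf_{\varepsilon\to0}E_\varepsilon(u_\varepsilon)$; (limsup) for every $u$ there exists $u_\varepsilon\rightharpoonup u$ weakly in $H^1(0,1)$ with $\limsup_{\varepsilon\to0}E_\varepsilon(u_\varepsilon)\le E(u)$. Values $+\infty$ are allowed for $G_\varepsilon$. It is a known (cited) result that $\Gamma\text{-}\lim_{\varepsilon\to0}F_\varepsilon$ exists and equals $F_{\rm hom}(u)=\int_0^1 f_{\rm hom}(u'(t))\,dt$, where $f_{\rm hom}$ is the convex function with $f_{\rm hom}(0)=\min V_{\rm per}$ and, for $\xi\ne0$, $f_{\rm hom}(\xi)=\min\big\{|\xi|\int_0^{1/|\xi|}\big(|v'(t)+\xi|^2+V_{\rm per}(v(t)+\xi t)\big)dt: v\in H^1_0(0,1/|\xi|)\big\}$. The claim means that the $\Gamma$-limit of $G_\varepsilon$ exists and coincides with that of $F_\varepsilon$. *)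

(* Defs.v *)
From HB Require Import structures.
From mathcomp Require Import all_boot all_order all_algebra.
From mathcomp Require Import all_classical all_reals all_analysis.
Import Order.TTheory GRing.Theory Num.Theory.
Import numFieldNormedType.Exports.

Set Implicit Arguments.
Unset Strict Implicit.
Unset Printing Implicit Defensive.

Local Open Scope classical_set_scope.
Local Open Scope ring_scope.

Definition Omega (R : realType) : set R := `]0, 1[.
Arguments Omega R : clear implicits.

(* Classes modulo a.e. equality are represented by total functions R -> R;
   every notion below only looks at their values on Omega. *)
Definition square_integrable (R : realType) (f : R -> R) : Prop :=
  measurable_fun (Omega R) f /\
  (\int[lebesgue_measure]_(t in Omega R) ((f t) ^+ 2)%:E < +oo)%E.

(* The test functions C^1_c(0,1), extended by 0 to the whole line. *)
Definition test_function (R : realType) (phi : R -> R) : Prop :=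
  [/\ forall t, derivable phi t 1,
      continuous (derive1 phi : R -> R) &
      exists a b : R, [/\ 0 < a, b < 1 &
        forall t, phi t != 0 -> a <= t <= b] ].

Definition is_weak_derivative (R : realType) (u g : R -> R) : Prop :=
  forall phi : R -> R, test_function phi ->
    \int[lebesgue_measure]_(t in Omega R) (u t * derive1 phi t) =
    - \int[lebesgue_measure]_(t in Omega R) (g t * phi t).

(* H^1(0,1). The weak derivative is unique up to a.e. equality; an element
   carries one of its representatives. *)
Record H1 (R : realType) := MkH1 {
  H1_fun :> R -> R;
  H1_deriv : R -> R;
  H1_fun_L2 : square_integrable H1_fun;
  H1_deriv_L2 : square_integrable H1_deriv;
  H1_derivP : is_weak_derivative H1_fun H1_deriv }.

Definition H1_inner (R : realType) (u v : H1 R) : R :=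
  \int[lebesgue_measure]_(t in Omega R) (u t * v t) +
  \int[lebesgue_measure]_(t in Omega R) (H1_deriv u t * H1_deriv v t).

(* Weak convergence, as eps -> 0+, in the Hilbert space H^1(0,1). *)
Definition weakly_cvg (R : realType) (u_ : R -> H1 R) (u : H1 R) : Prop :=
  forall v : H1 R, H1_inner (u_ eps) v @[eps --> 0^'+] --> H1_inner u v.

Definition is_Gamma_limit (R : realType)
    (E_ : R -> H1 R -> \bar R) (E : H1 R -> \bar R) : Prop :=
  (forall (u : H1 R) (u_ : R -> H1 R), weakly_cvg u_ u ->
     (E u <= limf_einf (fun eps => E_ eps (u_ eps)) 0^'+)%E) /\
  (forall u : H1 R, exists u_ : R -> H1 R, weakly_cvg u_ u /\
     (limf_esup (fun eps => E_ eps (u_ eps)) 0^'+ <= E u)%E).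

Definition F_energy (R : realType) (V : R -> R) (eps : R) (u : H1 R) : \bar R :=
  (\int[lebesgue_measure]_(t in Omega R)
     ((`|H1_deriv u t| ^+ 2 + V (u t / eps))%R)%:E)%E.

Definition G_energy (R : realType) (V W : R -> R) (eps : R) (u : H1 R) : \bar R :=
  (\int[lebesgue_measure]_(t in Omega R)
     ((`|H1_deriv u t| ^+ 2 + V (u t / eps) + W (u t / eps))%R)%:E)%E.

(* Main.v *)
Require Import Defs.
From HB Require Import structures.
From mathcomp Require Import all_boot all_order all_algebra.
From mathcomp Require Import all_classical all_reals all_analysis.
From mathcomp Require Import measurable_realfun.
From mathcomp Require Import ring lra.
Import Order.TTheory GRing.Theory Num.Theory.
Import numFieldNormedType.Exports.

Set Implicit Arguments.
Unset Strict Implicit.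
Unset Printing Implicit Defensive.

Local Open Scope classical_set_scope.
Local Open Scope ring_scope.

(** The common limit is the dual form of the homogenized functional. Write
    M c for the mean over a period of the square root of V + c, where c is
    such that V + c > 0. Completing the square gives, for every such c,

      u'^2 + V(u/eps) >= 2 sqrt(V(u/eps) + c) |u'| - c,

    and the first term on the right is the absolute derivative of
    2 eps Phi(u/eps), Phi being a primitive of sqrt(V + c), which converges to
    2 M c u because Phi(y) - M c y is periodic up to a constant. Hence on a mesh
    of (0,1), with one constant c_i for each cell of length 1/N, the lower limit
    of the energies is at least

      sum_i (2 M(c_i) |increment of u on the cell i| - c_i / N),

    and the limit functional Gamma_energy is the supremum of these sums over all
    meshes and constants. This bound uses only the convergence of u_eps at the
    nodes ([F_energy_liminf]). As W >= 0, it also holds with W in the energy.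

    Pointwise convergence comes from weak convergence because in dimension one
    the evaluation at a point is a scalar product with an explicit element of
    H^1, a hyperbolic cosine on each side of the point ([evaluation_riesz]).
    This presupposes continuous representatives: a function in H^1(0,1) is a
    primitive of its weak derivative, by the du Bois-Reymond lemma, which rests
    on the density of test functions in L^2.

    For the upper bound one recovery sequence, built for the energies with W,
    serves both functionals. To go from a to b on a cell, with mean slope xi,
    move along a solution of u' = k / q(u/eps), where q > 0 is continuous and
    1-periodic and the constant k is adjusted to the end points. The energy per
    unit of time tends to

      J(xi, q) = xi^2 M(q) M(1/q) + M(V q) / M(q)

    with M the mean over a period ([monotone_segment]). The choice
    q = 1 / sqrt(V + c), with c such that M(q) = 1 / |xi|, would give equality
    with the lower bound; when the slope is too small for such a c to exist, V
    is first levelled off near its minimum, at an arbitrarily small cost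
    ([cell_problem]). The term with W disappears on such a path: the speed is
    bounded below by a multiple of k, so that up to a factor the time integral
    of W(u/eps) is bounded by eps times the integral of W over an interval of
    length of order 1/eps, which tends to 0 ([expanding_integral]). On a cell
    where u has no increment the path goes up and comes back with a small slope,
    never staying still, since W need not be small at the minimizers of V
    ([transition_exists]). Gluing these paths along a fine mesh and a diagonal
    argument give the recovery sequence ([G_energy_limsup]). *)

(** * Integrals over compact intervals *)

Definition intble (R : realType) (a b : R) (f : R -> R) : Prop :=
  (@lebesgue_measure R).-integrable `[a, b] (EFin \o f).

Definition intg (R : realType) (a b : R) (f : R -> R) : R :=
  \int[@lebesgue_measure R]_(t in `[a, b]) f t.

Section SegmentIntegrals.
Context {R : realType}.
Implicit Types (a b c s t : R) (f g : R -> R).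
Local Notation mu := (@lebesgue_measure R).

Lemma segment_finite a b : (mu `[a, b]%classic < +oo)%E.
Proof.
rewrite lebesgue_measure_itv /=; case: ifP => // _.
by rewrite -EFinB ltry.
Qed.

Lemma intble_sub a b s t f : a <= s -> t <= b -> intble a b f -> intble s t f.
Proof.
move=> as_ tb; apply: integrableS => //.
by apply: subset_itv; rewrite bnd_simp.
Qed.

Lemma intble_meas a b f : intble a b f -> measurable_fun `[a, b] f.
Proof. by move=> /measurable_int/measurable_EFinP. Qed.

Lemma intbleD a b f g : intble a b f -> intble a b g ->
  intble a b (fun t => f t + g t).
Proof.
by move=> hf hg; exact: (integrableD _ hf hg).
Qed.

Lemma intbleZ a b k f : intble a b f -> intble a b (fun t => k * f t).
Proof.
by move=> hf; exact: (integrableZl _ k hf).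
Qed.

Lemma intbleN a b f : intble a b f -> intble a b (fun t => - f t).
Proof.
by move=> hf; exact: (integrableN hf).
Qed.

Lemma intbleB a b f g : intble a b f -> intble a b g ->
  intble a b (fun t => f t - g t).
Proof. by move=> hf hg; apply: intbleD => //; apply: intbleN. Qed.

Lemma intble_norm a b f : intble a b f -> intble a b (fun t => `|f t|).
Proof. by move=> hf; exact: (integrable_norm hf). Qed.

Lemma eq_intble a b f g : (forall t, a <= t <= b -> f t = g t) ->
  intble a b f -> intble a b g.
Proof.
move=> fg; apply: eq_integrable => // t; rewrite inE /= in_itv /= => tab.
by rewrite fg.
Qed.

Lemma bounded_intble a b f K : measurable_fun `[a, b] f ->
  (forall t, a <= t <= b -> `|f t| <= K) -> intble a b f.
Proof.
move=> mf fK; apply: measurable_bounded_integrable => //.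
  exact: segment_finite.
exists K; split; first exact: num_real.
move=> x Kx t /=; rewrite in_itv /= => tab.
by rewrite (le_trans (fK _ tab))// ltW.
Qed.

Lemma dominated_intble a b f g : measurable_fun `[a, b] f -> intble a b g ->
  (forall t, a <= t <= b -> `|f t| <= g t) -> intble a b f.
Proof.
move=> mf ig fg; apply: le_integrable ig => //; first exact/measurable_EFinP.
move=> t /=; rewrite in_itv /= => tab; rewrite lee_fin.
by rewrite (le_trans (fg _ tab))// ler_norm.
Qed.

Lemma intbleM a b f g K : measurable_fun `[a, b] f ->
  (forall t, a <= t <= b -> `|f t| <= K) -> intble a b g ->
  intble a b (fun t => f t * g t).
Proof.
move=> mf fK ig.
apply: (@dominated_intble _ _ _ (fun t => K * `|g t|)).
- apply: measurable_funM => //; exact: intble_meas.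
- by apply: intbleZ; exact: intble_norm.
- by move=> t tab; rewrite normrM ler_wpM2r// fK.
Qed.

Lemma continuous_intble a b f : continuous f -> intble a b f.
Proof.
move=> cf; apply: continuous_compact_integrable; first exact: segment_compact.
exact: continuous_subspaceT.
Qed.

Lemma intble_cst a b k : intble a b (fun=> k).
Proof. by apply: continuous_intble => x; exact: cst_continuous. Qed.

Lemma intble_cat a b c f : a <= c <= b -> intble a c f -> intble c b f ->
  intble a b f.
Proof.
move=> /andP[ac cb] h1 h2; rewrite /intble.
rewrite (@itv_bndbnd_setU _ _ (BLeft a) (BRight c))//.
have h2' : mu.-integrable `]c, b] (EFin \o f).
  apply: integrableS h2 => // t /=.
  by rewrite !in_itv /= => /andP[/ltW -> ->].
have mf : measurable_fun (`[a, c] `|` `]c, b]) (EFin \o f).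
  apply/measurable_funU => //; split; apply/measurable_EFinP.
    exact: intble_meas h1.
  have := intble_meas h2; apply: measurable_funS => //.
  by move=> t /=; rewrite !in_itv /= => /andP[/ltW -> ->].
apply/integrableP; split => //.
rewrite ge0_integral_setU //=.
- by apply: lte_add_pinfty; [case/integrableP: h1|case/integrableP: h2'].
- apply/measurable_EFinP/measurableT_comp => //.
  exact/measurable_EFinP.
- apply/disj_setPS => t [/=]; rewrite !in_itv /= => /andP[_ tc] /andP[].
  by rewrite ltNge tc.
Qed.

Lemma intg_cat a b c f : a <= c <= b -> intble a b f ->
  intg a b f = intg a c f + intg c b f.
Proof.
move=> /andP[ac cb] h; rewrite /intg.
rewrite -(@Rintegral_itv_obnd_cbnd _ c (BRight b)); last first.
  apply: integrableS h => //; apply: subset_itv; rewrite bnd_simp//.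
rewrite -(@Rintegral_itvB _ f (BLeft a) (BRight b) c)//; lra.
Qed.

Lemma intgD a b f g : intble a b f -> intble a b g ->
  intg a b (fun t => f t + g t) = intg a b f + intg a b g.
Proof. by move=> hf hg; exact: RintegralD. Qed.

Lemma intgB a b f g : intble a b f -> intble a b g ->
  intg a b (fun t => f t - g t) = intg a b f - intg a b g.
Proof. by move=> hf hg; exact: RintegralB. Qed.

Lemma intgZ a b k f : intble a b f ->
  intg a b (fun t => k * f t) = k * intg a b f.
Proof. by move=> hf; exact: RintegralZl. Qed.

Lemma eq_intg a b f g : (forall t, a <= t <= b -> f t = g t) ->
  intg a b f = intg a b g.
Proof.
by move=> fg; apply: eq_Rintegral => t; rewrite inE /= in_itv /=; exact: fg.
Qed.

Lemma le_intg a b f g : intble a b f -> intble a b g ->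
  (forall t, a <= t <= b -> f t <= g t) -> intg a b f <= intg a b g.
Proof.
move=> hf hg fg; apply: le_Rintegral => // t; rewrite /= in_itv /=; exact: fg.
Qed.

Lemma intg_ge0 a b f : (forall t, a <= t <= b -> 0 <= f t) -> 0 <= intg a b f.
Proof.
by move=> f0; apply: Rintegral_ge0 => t; rewrite /= in_itv /=; exact: f0.
Qed.

Lemma intg_norm a b f : intble a b f ->
  `|intg a b f| <= intg a b (fun t => `|f t|).
Proof. by move=> hf; exact: le_normr_Rintegral. Qed.

Lemma intg_cst a b k : a <= b -> intg a b (fun=> k) = k * (b - a).
Proof.
move=> ab; rewrite /intg Rintegral_cst //= lebesgue_measure_itv /= lte_fin.
by case: ltgtP ab => // -> _; rewrite subrr ?mulr0.
Qed.

Lemma intg01_cst k : intg 0 1 (fun=> k) = k :> R.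
Proof. by rewrite intg_cst ?ler01// subr0 mulr1. Qed.

Lemma intg_pt a f : intg a a f = 0.
Proof. by rewrite /intg set_itv1 Rintegral_set1. Qed.

Lemma intgE a b f : intble a b f ->
  (\int[mu]_(t in `[a, b]) (f t)%:E)%E = (intg a b f)%:E.
Proof.
move=> hf; rewrite /intg /Rintegral fineK//.
exact: (integrable_fin_num _ hf).
Qed.

End SegmentIntegrals.

(** * Absolutely continuous functions *)

(** Working with the pair (function, integrable derivative) and the integral
    identity avoids almost everywhere differentiability. *)
Definition abs_cont (R : realType) (a b : R) (f g : R -> R) : Prop :=
  intble a b g /\
  forall s t, a <= s -> s <= t -> t <= b -> intg s t g = f t - f s.

Section AbsolutelyContinuous.
Context {R : realType}.
Implicit Types (a b c s t : R) (f g : R -> R).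
Local Notation mu := (@lebesgue_measure R).

Lemma ac_sub a b s t f g : a <= s -> t <= b -> abs_cont a b f g -> abs_cont s t f g.
Proof.
move=> as_ tb [ig fg]; split; first exact: intble_sub ig.
by move=> x y sx xy yt; apply: fg => //; lra.
Qed.

(** Absolute continuity of the integral. *)
Lemma ac_ucont a b f g : abs_cont a b f g -> forall e, 0 < e -> exists2 d, 0 < d &
  forall s t, a <= s <= b -> a <= t <= b -> `|s - t| <= d -> `|f s - f t| <= e.
Proof.
move=> [ig fg] e e0.
have iT : mu.-integrable setT (EFin \o (g \_ `[a, b])).
  by rewrite -restrict_EFin; apply/integrable_restrict => //=; rewrite setTI.
have [d [d0 hd]] := integral_normr_continuous iT e0.
exists (d / 2) => [|s t]; first by rewrite divr_gt0.
wlog st : s t / s <= t => [hw|].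
  case: (leP s t) => [/hw//|/ltW /hw{}hw sab tab].
  by rewrite distrC => /(hw tab sab); rewrite distrC.
move=> /andP[as_ sb] /andP[at_ tb]; rewrite distrC ger0_norm ?subr_ge0// => std.
rewrite distrC -fg//.
apply: le_trans (intg_norm (intble_sub as_ tb ig)) _.
have mst : (mu `[s, t]%classic < d%:E)%E.
  rewrite lebesgue_measure_itv /= lte_fin.
  by case: ifP => _; rewrite lte_fin; lra.
have hd' := hd `[s, t]%classic (measurable_itv _) mst.
have e1 : intg s t (fun x => `|g x|) = \int[mu]_(x in `[s, t]) `|(g \_ `[a, b]) x|.
  apply: eq_Rintegral => x; rewrite inE /= in_itv /= => /andP[sx xt].
  by rewrite patchE mem_set//= in_itv /= (le_trans as_ sx) (le_trans xt tb).
by rewrite e1; apply/ltW/hd'.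
Qed.

Lemma ucont_within a b f :
  (forall e, 0 < e -> exists2 d, 0 < d & forall s t, a <= s <= b ->
     a <= t <= b -> `|s - t| <= d -> `|f s - f t| <= e) ->
  {within `[a, b], continuous f}.
Proof.
move=> uc; apply/subspace_continuousP => x; rewrite /= in_itv /= => xab.
apply/cvgrPdist_le => e e0; have [d d0 hd] := uc _ e0.
have h : \forall t \near x, `|x - t| <= d.
  by exists d => //= t; rewrite /ball_/= => /ltW.
rewrite near_withinE; near=> t; rewrite /= in_itv /= => tab.
by apply: hd => //; near: t.
Unshelve. all: by end_near. Qed.

Lemma ac_within a b f g : abs_cont a b f g -> {within `[a, b], continuous f}.
Proof. by move=> /ac_ucont; exact: ucont_within. Qed.

Lemma ac_meas a b f g : abs_cont a b f g -> measurable_fun `[a, b] f.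
Proof.
move=> /ac_within cf; apply: subspace_continuous_measurable_fun => //.
Qed.

Lemma ac_bounded a b f g : abs_cont a b f g ->
  exists2 K, 0 < K & forall t, a <= t <= b -> `|f t| <= K.
Proof.
move=> [ig fg]; exists (`|f a| + intg a b (fun t => `|g t|) + 1).
  rewrite ltr_wpDl// addr_ge0// intg_ge0//.
move=> t /andP[at_ tb].
have -> : f t = f a + intg a t g by rewrite fg//; lra.
rewrite -addrA; apply: le_trans (ler_normD _ _) _; rewrite lerD2l.
have ig1 := intble_sub (lexx a) tb ig.
apply: le_trans (intg_norm ig1) _.
have /= -> := @intg_cat _ a b t (fun t => `|g t|).
- by rewrite -addrA lerDl addr_ge0// intg_ge0.
- by rewrite at_.
- exact: intble_norm.
Qed.

Lemma ac_lin a b k l f g F G : abs_cont a b f g -> abs_cont a b F G ->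
  abs_cont a b (fun t => k * f t + l * F t) (fun t => k * g t + l * G t).
Proof.
move=> [ig fg] [iG FG]; split; first by apply: intbleD; exact: intbleZ.
move=> s t as_ st tb.
have igs := intble_sub as_ tb ig; have iGs := intble_sub as_ tb iG.
rewrite intgD ?intgZ ?fg ?FG//; first lra.
all: exact: intbleZ.
Qed.

(** Cut [a, b] into pieces shorter than the threshold and add up. *)
Lemma additive_local (D : R -> R -> R) a b : a <= b ->
  (forall s r t, a <= s -> s <= r -> r <= t -> t <= b ->
     D s r + D r t <= D s t) ->
  (exists2 d, 0 < d & forall s t, a <= s -> s <= t -> t <= b -> t - s <= d ->
     0 <= D s t) -> 0 <= D a b.
Proof.
move=> ab Dadd [d d0 hD].
have H n : forall s t, a <= s -> s <= t -> t <= b -> t - s <= n.+1%:R * d ->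
    0 <= D s t.
  elim: n => [|n IH] s t as_ st tb.
    by rewrite mul1r; exact: hD.
  move=> h; have [tsd|tsd] := leP (t - s) d; first exact: hD.
  rewrite (le_trans _ (Dadd s (s + d) t _ _ _ _))//; try lra.
  apply: addr_ge0; first by apply: hD => //; lra.
  apply: IH => //; try lra.
pose n := Num.truncn ((b - a) / d).
apply: (H n) => //.
rewrite -ler_pdivrMr//; apply/ltW; rewrite /n.
by apply: truncnS_gt.
Qed.

(** To identify the derivative of f it suffices to control the error at first
    order on short intervals, by a small multiple of an additive quantity: the
    errors then add up to a small multiple of a fixed number. *)
Lemma ac_local a b f g m : intble a b g -> intble a b m ->
  (forall e, 0 < e -> exists2 d, 0 < d & forall s t, a <= s -> s <= t ->
     t <= b -> t - s <= d ->
     `|f t - f s - intg s t g| <= e * intg s t m) -> abs_cont a b f g.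
Proof.
move=> ig im H; split => // s t as_ st tb.
have igs := intble_sub as_ tb ig; have ims := intble_sub as_ tb im.
suff h e : 0 < e -> `|f t - f s - intg s t g| <= e * intg s t m.
  apply/eqP; rewrite eq_sym -subr_eq0 -normr_le0; apply/ler_addgt0Pl => e e0.
  rewrite addr0.
  have M0 : 0 < `|intg s t m| + 1 by rewrite ltr_wpDl.
  apply: le_trans (h (e / (`|intg s t m| + 1)) _) _; first by rewrite divr_gt0.
  rewrite mulrAC ler_pdivrMr//; apply: ler_wpM2l; first exact: ltW.
  by apply: le_trans (ler_norm _) _; rewrite lerDl.
move=> e0; have [d d0 hd] := H _ e0.
pose D s t := e * intg s t m - `|f t - f s - intg s t g|.
suff : 0 <= D s t by rewrite subr_ge0.
apply: additive_local => // [x r y sx xr ry yt|]; last first.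
  exists d => // x y sx xy yt xyd; rewrite subr_ge0; apply: hd => //; lra.
have xry : x <= r <= y by rewrite xr.
have h1 := intg_cat xry (intble_sub sx yt igs).
have h2 := intg_cat xry (intble_sub sx yt ims).
rewrite /D h1 h2.
have := ler_normD (f y - f r - intg r y g) (f r - f x - intg x r g).
have -> : f y - f r - intg r y g + (f r - f x - intg x r g) =
  f y - f x - (intg x r g + intg r y g) by ring.
lra.
Qed.

End AbsolutelyContinuous.

(** * Chain rule, product rule and primitives of continuous functions *)

Section ChainRule.
Context {R : realType}.
Implicit Types (a b c s t x y : R) (f g phi Phi : R -> R).
Local Notation mu := (@lebesgue_measure R).

(** Compactness in its near-covering form yields the uniform modulus. *)
Lemma heine phi a b : continuous phi -> forall e, 0 < e ->
  exists2 d, 0 < d & forall s t, a <= s <= b -> a <= t <= b ->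
    `|s - t| <= d -> `|phi s - phi t| <= e.
Proof.
move=> cphi e e0.
have /compact_near_coveringP cc := @segment_compact R a b.
pose P (d : R) (s : R) := forall t, `|s - t| <= d -> `|phi s - phi t| <= e.
have : \forall d \near (0 : R)^'+, `[a, b]%classic `<=` P d.
  apply: cc => x _.
  have /cvgrPdist_le/(_ (e / 2)) : phi y @[y --> x] --> phi x by exact: cphi.
  rewrite divr_gt0// => /(_ isT)[r /= r0 hr].
  exists (ball x (r / 2), [set d | 0 < d < r / 2]).
    split => /=; first by apply: nbhsx_ballx; rewrite divr_gt0.
    by near=> d; apply/andP; split; near: d;
      [exact: nbhs_right_gt|apply: nbhs_right_lt; rewrite divr_gt0].
  move=> [s d] /= [xs /andP[d0 dr]] t st.
  have h1 : `|phi x - phi s| <= e / 2.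
    by apply: hr; rewrite /ball_/=; apply: lt_le_trans xs _; lra.
  have h2 : `|phi x - phi t| <= e / 2.
    apply: hr; rewrite /ball_/=.
    have -> : x - t = (x - s) + (s - t) by ring.
    apply: le_lt_trans (ler_normD _ _) _.
    by move: xs; rewrite /ball_/=/ball/= => xs; lra.
  have -> : phi s - phi t = (phi x - phi t) - (phi x - phi s) by ring.
  by apply: le_trans (ler_normB _ _) _; lra.
move=> H.
have [d [d0 hd]] : exists d : R, 0 < d /\ `[a, b]%classic `<=` P d.
  near (0 : R)^'+ => d; exists d; split => //.
  by near: d.
exists d => // s t sab _ st; apply: hd => //=.
Unshelve. all: by end_near. Qed.

Lemma intg_reversed a b f : b <= a -> intg a b f = 0.
Proof.
rewrite le_eqVlt => /predU1P[->|ba]; first exact: intg_pt.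
by rewrite /intg set_itv_ge ?Rintegral_set0// -leNgt bnd_simp.
Qed.

(** The mean value theorem without an order on the end points. *)
Lemma mean_value_between Phi phi x y : (forall t, is_derive t 1 Phi (phi t)) ->
  exists z, Phi y - Phi x = phi z * (y - x) /\ Num.min x y <= z <= Num.max x y.
Proof.
move=> dPhi.
have cPhi : continuous Phi.
  by move=> t; apply/differentiable_continuous/derivable1_diffP.
have [xy|/ltW yx] := leP x y.
  have [z zi hz] := MVT_segment xy (fun t _ => dPhi t)
    (continuous_subspaceT cPhi).
  by exists z; split => //; move: zi; rewrite in_itv.
have [z zi hz] := MVT_segment yx (fun t _ => dPhi t)
  (continuous_subspaceT cPhi).
exists z; split; last by move: zi; rewrite in_itv.
by rewrite -opprB hz -mulrN opprB.
Qed.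

Lemma ac_smooth a b f g : (forall t, is_derive t 1 f (g t)) -> continuous g ->
  abs_cont a b f g.
Proof.
move=> df cg; split; first exact: continuous_intble.
move=> s t _; rewrite le_eqVlt => /predU1P[-> _|st _].
  by rewrite intg_pt subrr.
have cf : continuous f.
  by move=> x; apply/differentiable_continuous/derivable1_diffP.
have := @continuous_FTC2 _ g f s t st.
rewrite intgE; last exact: continuous_intble.
rewrite -EFinB => h; apply: EFin_inj; apply: h.
- exact: continuous_subspaceT.
- split.
  + by move=> x _.
  + by apply: cvg_at_right_filter; exact: cf.
  + by apply: cvg_at_left_filter; exact: cf.
- by move=> x _; rewrite derive1E; exact: derive_val.
Qed.

Lemma continuous_inv f : continuous f -> (forall s, f s != 0) ->
  continuous (fun s => (f s)^-1).
Proof. by move=> cf f0 x; apply: cvgV => //; exact: cf. Qed.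

(** A primitive on the whole line, so the integral from 0 has to be taken with
    its sign; one of the two terms always vanishes. *)
Lemma primitive_exists g : continuous g ->
  exists f, f 0 = 0 /\ forall t, is_derive t 1 f (g t).
Proof.
move=> cg; exists (fun t => intg 0 t g - intg t 0 g); split.
  by rewrite intg_pt subrr.
move=> x; pose a : R := - (`|x| + 1); pose u : R := `|x| + 1.
have xn := ler_norm x; have xn' := ler_normr x (- x).
have xn2 : - x <= `|x| by rewrite -normrN ler_norm.
have ax : a < x by rewrite /a; lra.
have xu : x < u by rewrite /u; lra.
have [dG G'] := @continuous_FTC1_closed _ g a x u xu
  (continuous_intble a u cg) ax (cg x).
have H : is_derive x 1 (fun t => intg a t g - intg a 0 g) (g x - 0).
  apply: is_deriveB; split; first exact: dG.
  by rewrite -derive1E.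
rewrite subr0 in H.
apply: near_eq_is_derive H => //.
near=> t.
have at_ : a <= t by apply/ltW; near: t; exact: lt_nbhsr.
have a0 : a <= 0 by rewrite /a; lra.
have [t0|/ltW t0] := leP 0 t.
  rewrite (@intg_cat _ a t 0 g) ?at_//; last exact: continuous_intble.
    by rewrite (intg_reversed _ t0) subr0 addrAC subrr add0r.
  by rewrite a0.
rewrite (@intg_cat _ a 0 t g) ?at_//; last exact: continuous_intble.
by rewrite (intg_reversed _ t0) sub0r opprD addrA subrr add0r.
Unshelve. all: by end_near. Qed.

(** On a short interval the mean value theorem replaces the increment of Phi by
    phi z times the increment of f, with z close to all values of f there. *)
Lemma ac_chain a b f g Phi phi : abs_cont a b f g ->
  (forall t, is_derive t 1 Phi (phi t)) -> continuous phi ->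
  abs_cont a b (Phi \o f) (fun t => phi (f t) * g t).
Proof.
move=> hf dPhi cphi; have [ig fg] := hf.
have [K K0 fK] := ac_bounded hf.
have cf := ac_within hf.
have cphif : {within `[a, b], continuous (phi \o f)}.
  move=> x; apply: (@continuous_comp (subspace `[a, b]) R R f phi).
    exact: cf.
  exact: cphi.
have mphif : measurable_fun `[a, b] (fun t => phi (f t)).
  by apply: subspace_continuous_measurable_fun.
have [C [_ hC]] := compact_bounded (continuous_compact cphif (@segment_compact _ a b)).
have ipg : intble a b (fun t => phi (f t) * g t).
  apply: (@intbleM _ _ _ _ _ (C + 1)) => // t tab.
  by apply: hC; [rewrite ltrDl|exists t => //=; rewrite in_itv].
apply: (ac_local ipg (intble_norm ig)) => e e0.
have [d1 d10 hd1] := heine (- K) K cphi e0.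
have [d d0 hd] := ac_ucont hf (divr_gt0 d10 (ltr0Sn _ 1)).
exists d => // s t as_ st tb tsd.
have [z [hz1 hz2]] := mean_value_between (f s) (f t) dPhi.
have igs := intble_sub as_ tb ig.
have h1 : forall r, s <= r <= t -> `|phi z - phi (f r)| <= e.
  move=> r /andP[sr rt].
  have sI : a <= s <= b by rewrite as_ (le_trans st).
  have tI : a <= t <= b by rewrite tb (le_trans as_).
  have rI : a <= r <= b by rewrite (le_trans as_) ?(le_trans rt).
  have near_r x : a <= x <= b -> `|x - r| <= d -> `|f x - f r| <= d1 / 2.
    by move=> xI xr; exact: hd.
  have /ler_normlP[a1 a2] : `|f s - f r| <= d1 / 2.
    apply: near_r => //; rewrite distrC ger0_norm ?subr_ge0//.
    by apply: le_trans tsd; rewrite lerD2r.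
  have /ler_normlP[b1 b2] : `|f t - f r| <= d1 / 2.
    apply: near_r => //; rewrite ger0_norm ?subr_ge0//.
    by apply: le_trans tsd; rewrite lerD2l lerN2.
  have /andP[c1 c2] : - K <= f r <= K by rewrite -ler_norml fK.
  have /andP[c3 c4] : - K <= f t <= K by rewrite -ler_norml fK.
  have /andP[c5 c6] : - K <= f s <= K by rewrite -ler_norml fK.
  have {}hz2 : (f s <= z <= f t) || (f t <= z <= f s).
    by move: hz2; case: (leP (f s) (f t)) => _ ->; rewrite ?orbT.
  apply: hd1.
  - by clear -hz2 c3 c4 c5 c6; case/orP: hz2 => /andP[u1 u2]; apply/andP; split; lra.
  - by apply/andP.
  - clear -hz2 a1 a2 b1 b2; apply/ler_normlP.
    by case/orP: hz2 => /andP[u1 u2]; split; lra.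
have ipgs := intble_sub as_ tb ipg.
have iz : intble s t (fun r => phi z * g r) by apply: intbleZ.
rewrite /= hz1 -(fg s t)// -intgZ// -intgB//.
apply: le_trans (intg_norm (intbleB iz ipgs)) _.
rewrite -intgZ; last exact: intble_norm.
apply: le_intg => [| |r sr].
- exact/intble_norm/intbleB.
- exact/intbleZ/intble_norm.
- by rewrite -mulrBl normrM ler_wpM2r// h1.
Qed.

(** Polarization: the product is a combination of the squares of f + F and
    f - F, to which the chain rule applies. *)
Lemma ac_mul a b f g F G : abs_cont a b f g -> abs_cont a b F G ->
  abs_cont a b (fun t => f t * F t) (fun t => g t * F t + f t * G t).
Proof.
move=> h H.
have sq (k : R -> R) k' : abs_cont a b k k' ->
    abs_cont a b ((fun x => x ^+ 2) \o k) (fun t => 2 * k t * k' t).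
  move=> hk; apply: (ac_chain hk (phi := fun x => 2 * x)).
    move=> t; apply: is_derive_eq; rewrite /GRing.scale/=; ring.
  by move=> x; apply: cvgM; [exact: cvg_cst|exact: cvg_id].
have h1 := sq _ _ (ac_lin 1 1 h H); have h2 := sq _ _ (ac_lin 1 (-1) h H).
have := ac_lin (1/4) (-(1/4)) h1 h2.
set A := (X in abs_cont _ _ X _); set B := (X in abs_cont _ _ _ X).
have -> : A = (fun t => f t * F t) by apply/funext => t; rewrite /A/=; field.
suff -> : B = (fun t => g t * F t + f t * G t) by [].
by apply/funext => t; rewrite /B/=; field.
Qed.

End ChainRule.

(** * Square integrable functions *)

Definition L2 (R : realType) (a b : R) (f : R -> R) : Prop :=
  measurable_fun `[a, b] f /\ intble a b (fun t => f t ^+ 2).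

Section Density.
Context {R : realType}.
Implicit Types (a b c s t x y : R) (f g w W phi : R -> R).
Local Notation mu := (@lebesgue_measure R).

Lemma continuous_meas a b f : continuous f -> measurable_fun `[a, b] f.
Proof.
move=> cf; apply: subspace_continuous_measurable_fun => //.
exact: continuous_subspaceT.
Qed.

Lemma L2_mul a b f g : L2 a b f -> L2 a b g -> intble a b (fun t => f t * g t).
Proof.
move=> [mf if2] [mg ig2].
apply: (dominated_intble _ (intbleD if2 ig2)) => [|t _].
  exact: measurable_funM.
rewrite normrM -[f t ^+ 2]real_normK ?num_real// -[g t ^+ 2]real_normK ?num_real//.
by have := sqr_ge0 (`|f t| - `|g t|); have := sqr_ge0 (`|f t| + `|g t|); lra.
Qed.

Lemma L2_cst a b k : L2 a b (fun=> k).
Proof. by split; [exact: measurable_cst|exact: intble_cst]. Qed.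

Lemma L2_intble a b f : L2 a b f -> intble a b f.
Proof.
move=> h; have := L2_mul h (L2_cst a b 1).
by apply: eq_intble => t _; rewrite mulr1.
Qed.

Lemma L2_lin a b k l f g : L2 a b f -> L2 a b g ->
  L2 a b (fun t => k * f t + l * g t).
Proof.
move=> h1 h2; have ifg := L2_mul h1 h2.
case: h1 => mf if2; case: h2 => mg ig2; split.
  by apply: measurable_funD; apply: measurable_funM => //; exact: measurable_cst.
have h := intbleD (intbleD (intbleZ (k ^+ 2) if2) (intbleZ (l ^+ 2) ig2))
   (intbleZ (2 * k * l) ifg).
by apply: eq_intble h => t _; ring.
Qed.

Lemma L2_bounded a b f K : measurable_fun `[a, b] f ->
  (forall t, a <= t <= b -> `|f t| <= K) -> L2 a b f.
Proof.
move=> mf fK; split => //.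
apply: (@bounded_intble _ _ _ _ (K ^+ 2)) => [|t tab].
  exact: measurable_funX.
by rewrite normrX lerXn2r ?nnegrE ?fK// (le_trans _ (fK _ tab)).
Qed.

Lemma L2_triangle a b f g h : L2 a b f -> L2 a b g -> L2 a b h ->
  intg a b (fun t => (f t - h t) ^+ 2) <=
  2 * intg a b (fun t => (f t - g t) ^+ 2) +
  2 * intg a b (fun t => (g t - h t) ^+ 2).
Proof.
have sqrB (k l : R -> R) : L2 a b k -> L2 a b l ->
    intble a b (fun t => (k t - l t) ^+ 2).
  by move=> Lk Ll; have [_] := L2_lin 1 (-1) Lk Ll; apply: eq_intble => t _; ring.
move=> Lf Lg Lh.
rewrite -!intgZ -?intgD; try by do ?apply: intbleZ; exact: sqrB.
apply: le_intg => [||t _]; first exact: sqrB.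
  by apply: intbleD; apply: intbleZ; exact: sqrB.
have := sqr_ge0 ((f t - g t) - (g t - h t)); lra.
Qed.

(** Dominated convergence, in the form used for truncations and mollifications. *)
Lemma L2_dct a b (f_ : nat -> R -> R) f G :
  (forall n, measurable_fun `[a, b] (f_ n)) -> measurable_fun `[a, b] f ->
  {ae mu, forall x, `[a, b]%classic x -> f_ n x @[n --> \oo] --> f x} ->
  intble a b G -> (forall n t, a <= t <= b -> (f t - f_ n t) ^+ 2 <= G t) ->
  forall e, 0 < e ->
    \forall n \near \oo, intg a b (fun t => (f t - f_ n t) ^+ 2) <= e.
Proof.
move=> mf_ mf ff iG hG e e0.
have md n : measurable_fun `[a, b] (fun t => (f t - f_ n t) ^+ 2).
  by apply: measurable_funX; apply: measurable_funB.
have [] := @dominated_convergence _ _ R mu `[a, b]%classic (measurable_itv _)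
  (fun n t => ((f t - f_ n t) ^+ 2)%:E) (fun=> 0%E) (EFin \o G).
- by move=> n; apply/measurable_EFinP; exact: md.
- exact: measurable_cst.
- have FF := ae_filter_ringOfSetsType mu.
  apply: filterS ff => x h xab.
  have -> : 0%E = ((f x - f x) ^+ 2)%:E by rewrite subrr expr0n.
  apply: cvg_EFin; first by near=> n.
  rewrite /comp /=; apply: cvgM; apply: cvgB;
    [exact: cvg_cst|exact: h|exact: cvg_cst|exact: h].
- exact: iG.
- apply: aeW => x n /=; rewrite in_itv /= => xab.
  by rewrite lee_fin ger0_norm ?sqr_ge0// hG.
move=> _ _ /=; rewrite integral0.
move=> /fine_cvgP [_] /cvgrPdist_le /(_ _ e0) [N _ hN].
exists N => // n Nn; have /= := hN n Nn.
by rewrite sub0r normrN ger0_norm//; apply: intg_ge0 => t _; exact: sqr_ge0.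
Unshelve. all: by end_near. Qed.

End Density.

(** * Density of test functions in the square integrable functions *)

Definition diff_quotient (R : realType) (h : R) (W : R -> R) (t : R) : R :=
  (W (t + h) - W t) / h.

Section Mollification.
Context {R : realType}.
Implicit Types (a b c s t x y : R) (f g w W phi : R -> R).
Local Notation mu := (@lebesgue_measure R).

Lemma lipschitz_continuous W K : (forall s t, `|W s - W t| <= K * `|s - t|) ->
  continuous W.
Proof.
move=> lip x; apply/cvgrPdist_le => e e0.
have K0 : 0 < `|K| + 1 by rewrite ltr_wpDl.
exists (e / (`|K| + 1)) => /=; first by rewrite divr_gt0.
move=> t; rewrite /ball_/= ltr_pdivlMr// => h.
apply: le_trans (lip _ _) _; apply: le_trans (ltW h).
rewrite mulrC ler_wpM2l//; have := ler_norm K; lra.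
Qed.

Lemma diff_quotient_bound W K h t : 0 < h ->
  (forall s t, `|W s - W t| <= K * `|s - t|) -> `|diff_quotient h W t| <= K.
Proof.
move=> h0 lip; rewrite /diff_quotient normrM normfV (gtr0_norm h0) ler_pdivrMr//.
by apply: le_trans (lip _ _) _; rewrite addrAC subrr add0r gtr0_norm.
Qed.

Lemma diff_quotient_continuous W h : continuous W -> continuous (diff_quotient h W).
Proof.
move=> cW x; apply: cvgM; last exact: cvg_cst.
apply: cvgB; last exact: cW.
apply: (@cvg_comp _ _ _ (fun t => t + h) W); last exact: cW.
by apply: cvgD; [exact: cvg_id|exact: cvg_cst].
Qed.

(** By Lebesgue differentiation the difference quotients of the primitive W of w
    converge almost everywhere, and the Lipschitz bound dominates them. *)
Lemma diff_quotient_L2 W w K : (forall s t, `|W s - W t| <= K * `|s - t|) ->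
  measurable_fun `[(0 : R), 1] w -> (forall t, `|w t| <= K) ->
  {ae mu, forall x, `[(0 : R), 1]%classic x -> derivable W x 1 /\ derive1 W x = w x} ->
  forall e h0, 0 < e -> 0 < h0 -> exists2 h, 0 < h < h0 &
    intg 0 1 (fun t => (w t - diff_quotient h W t) ^+ 2) <= e.
Proof.
move=> lip mw wK dW e h0 e0 h00.
have cW := lipschitz_continuous lip.
pose h_ (n : nat) : R := n.+1%:R^-1.
have h_0 n : 0 < h_ n by rewrite invr_gt0.
have := @L2_dct R 0 1 (fun n => diff_quotient (h_ n) W) w (fun=> (K + K) ^+ 2).
have K0 : 0 <= K by apply: le_trans (wK 0).
case/(_ _ _ _ _ _ e e0).
- move=> n; apply: subspace_continuous_measurable_fun => //.
  by apply: continuous_subspaceT; exact: diff_quotient_continuous.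
- exact: mw.
- have FF := ae_filter_ringOfSetsType mu.
  apply: filterS dW => x /= dWx x01; have [dx <-] := dWx x01.
  have /cvg_ex[l hl] := dx.
  rewrite derive1E /derive (cvg_lim _ hl)//.
  have h_cvg : h_ @ \oo --> (0 : R)^'.
    move=> A [r /= r0 hA].
    have /cvgrPdist_lt/(_ _ r0) : h_ @ \oo --> (0 : R) by exact: cvg_harmonic.
    apply: filterS => n /hA; apply; exact: lt0r_neq0.
  have := cvg_comp h_ _ h_cvg hl.
  apply: cvg_trans; apply: near_eq_cvg; apply: nearW => n /=.
  by rewrite /diff_quotient /GRing.scale /= mulr1 mulrC (addrC x).
- exact: intble_cst.
- move=> n t _; rewrite -real_normK ?num_real// lerXn2r ?nnegrE//.
    by rewrite addr_ge0.
  apply: le_trans (ler_normB _ _) _; apply: lerD => //.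
  exact: diff_quotient_bound.
move=> N _ hN.
have [M _ hM] : \forall n \near \oo, h_ n < h0.
  by apply: (cvgr_lt 0) => //; exact: cvg_harmonic.
exists (h_ (maxn M N)); last by apply: hN; rewrite /= leq_maxr.
by rewrite h_0 hM//= leq_maxl.
Qed.

(** Two successive difference quotients of primitives make w continuous, then
    continuously differentiable, and move the support by as little as desired. *)
Lemma bounded_density w K d : measurable_fun setT w -> (forall t, `|w t| <= K) ->
  0 < d <= 1 / 2 -> (forall t, w t != 0 -> d < t < 1 - d) ->
  forall e, 0 < e -> exists2 phi, test_function phi &
    intg 0 1 (fun t => (w t - phi t) ^+ 2) <= e.
Proof.
move=> mw wK /andP[d0 d12] wd e e0.
have K0 : 0 <= K by apply: le_trans (wK 0).
have mwi a b : measurable_fun `[a, b] w by exact: measurable_funS mw.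
have iw a b : intble a b w by apply: bounded_intble (mwi a b) (fun t _ => wK t).
have w0 t : (t <= d) || (1 - d <= t) -> w t = 0.
  by apply: contraTeq => /wd; rewrite negb_or -!ltNge.
pose W t := intg (-1) t w.
have W1 s t : -1 <= s -> s <= t -> W t = W s + intg s t w.
  by move=> s1 st; rewrite /W (@intg_cat _ (-1) t s)// s1.
have iK s t : s <= t -> `|intg s t w| <= K * (t - s).
  move=> st; rewrite -intg_cst//; apply: le_trans (intg_norm (iw _ _)) _.
  by apply: le_intg => //; [exact: intble_norm|exact: intble_cst].
have lipW s t : `|W s - W t| <= K * `|s - t|.
  wlog st : s t / s <= t => [hw|].
    case: (leP s t) => [/hw//|/ltW/hw].
    by rewrite distrC (distrC t).
  rewrite distrC (distrC s) (ger0_norm (_ : 0 <= t - s)) ?subr_ge0//.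
  have [s1|/ltW s1] := leP (-1) s.
    by rewrite (W1 _ _ s1 st) addrAC subrr add0r iK.
  rewrite {2}/W intg_reversed// subr0; have [t1|/ltW t1] := leP (-1) t.
    by apply: le_trans (iK _ _ t1) _; rewrite ler_wpM2l//; lra.
  by rewrite /W intg_reversed// normr0 mulr_ge0// subr_ge0.
have cW := lipschitz_continuous lipW.
have Wl t : t <= d -> W t = 0.
  move=> td; have [t1|/ltW t1] := leP (-1) t; last exact: intg_reversed.
  rewrite /W (@eq_intg _ _ _ _ (fun=> 0)) ?intg_cst ?mul0r// => s /andP[_ st].
  by rewrite w0// (le_trans st td).
have Wr t : 1 - d <= t -> W t = W (1 - d).
  move=> td; rewrite (W1 (1 - d) t)//; last lra.
  rewrite [X in _ + X](@eq_intg _ _ _ _ (fun=> 0)) ?intg_cst ?mul0r ?addr0//.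
  by move=> s /andP[ds _]; rewrite w0// ds orbT.
have [h1 /andP[h10 h1d] E1] : exists2 h, 0 < h < d / 2 &
    intg 0 1 (fun t => (w t - diff_quotient h W t) ^+ 2) <= e / 4.
  apply: diff_quotient_L2 => //; try lra.
  have lw : locally_integrable setT w.
    split; [exact: mw|exact: openT|].
    move=> C _ cC; have mC : measurable C by exact: compact_measurable.
    have /integrableP[_ /=] : mu.-integrable C (EFin \o w).
      apply: measurable_bounded_integrable => //.
      - exact: compact_finite_measure.
      - exact: measurable_funS mw.
      - exists K; split; first exact: num_real.
        by move=> y Ky t _; exact: le_trans (wK t) (ltW Ky).
    by [].
  have FF := ae_filter_ringOfSetsType mu.
  apply: filterS (@FTC1 R w (BLeft (-1)) (iw _) lw) => x hx.
  by rewrite /= in_itv /= => /andP[x0 _]; apply: hx; rewrite lte_fin; lra.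
set p := diff_quotient h1 W in E1.
have cp : continuous p by apply: diff_quotient_continuous.
have pK t : `|p t| <= K by apply: diff_quotient_bound.
have [P [_ dP]] := primitive_exists cp.
have lipP s t : `|P s - P t| <= K * `|s - t|.
  have [z [-> _]] := mean_value_between t s dP.
  by rewrite normrM ler_wpM2r.
have p0 t : (t <= d / 2) || (1 - d <= t) -> p t = 0.
  move=> /orP[] td; rewrite /p /diff_quotient.
    by rewrite !Wl ?subrr ?mul0r//; lra.
  by rewrite (Wr t) ?(Wr (t + h1)) ?subrr ?mul0r//; lra.
have [h2 /andP[h20 h2d] E2] : exists2 h, 0 < h < d / 4 &
    intg 0 1 (fun t => (p t - diff_quotient h P t) ^+ 2) <= e / 4.
  apply: diff_quotient_L2 => //; try lra.
    by apply: subspace_continuous_measurable_fun => //; exact: continuous_subspaceT.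
  apply: aeW => x _; split; first by case: (dP x).
  by rewrite derive1E; case: (dP x).
have cP : continuous P := lipschitz_continuous lipP.
have Pl t : t <= d / 2 -> P t = P (d / 2).
  move=> td; apply/eqP; rewrite -subr_eq0.
  have [z [-> ]] := mean_value_between (d / 2) t dP.
  rewrite (max_idPl td) => /andP[_ zd].
  by rewrite p0 ?zd// mul0r.
have Pr t : 1 - d <= t -> P t = P (1 - d).
  move=> td; apply/eqP; rewrite -subr_eq0.
  have [z [-> ]] := mean_value_between (1 - d) t dP.
  rewrite (min_idPl td) => /andP[zd _].
  by rewrite p0 ?zd ?orbT// mul0r.
have dphi t : is_derive t 1 (diff_quotient h2 P) ((p (t + h2) - p t) / h2).
  have dPs : is_derive t 1 (fun t => P (t + h2)) (p (t + h2)).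
    have dsh : is_derive t 1 (fun t => t + h2) (1 + 0).
      by apply: is_deriveD.
    rewrite addr0 in dsh.
    have := @is_derive1_comp R P (fun t => t + h2) t _ _ (dP (t + h2)) dsh.
    by rewrite mulr1.
  have := is_deriveZ h2^-1 (is_deriveB dPs (dP t)).
  rewrite /GRing.scale /= mulrC.
  set f := (X in is_derive _ _ X _); suff -> : f = diff_quotient h2 P by [].
  by apply/funext => x; rewrite /f /diff_quotient /= mulrC.
exists (diff_quotient h2 P).
  split.
  - by move=> t; case: (dphi t).
  - have -> : derive1 (diff_quotient h2 P) = diff_quotient h2 p.
      by apply/funext => t; rewrite derive1E derive_val.
    exact: diff_quotient_continuous.
  - exists (d / 4), (1 - d / 4); split; try lra.
    move=> t; apply: contraNT; rewrite negb_and -!ltNge => /orP[] td;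
      apply/eqP; rewrite /diff_quotient.
      by rewrite (Pl t) ?(Pl (t + h2)) ?subrr ?mul0r//; lra.
    by rewrite (Pr t) ?(Pr (t + h2)) ?subrr ?mul0r//; lra.
have Lw : L2 0 1 w by apply: L2_bounded (mwi 0 1) (fun t _ => wK t).
have Lp : L2 0 1 p by apply: L2_bounded (continuous_meas cp) (fun t _ => pK t).
have Lq : L2 0 1 (diff_quotient h2 P).
  apply: (@L2_bounded _ _ _ _ K) => [|t _]; last exact: diff_quotient_bound.
  by apply: continuous_meas; apply: diff_quotient_continuous; exact: cP.
apply: le_trans (L2_triangle Lw Lp Lq) _; lra.
Qed.

End Mollification.

Section TestFunctions.
Context {R : realType}.
Implicit Types (a b c s t x y : R) (f g w phi : R -> R).
Local Notation mu := (@lebesgue_measure R).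

Lemma continuous_L2 a b f : continuous f -> L2 a b f.
Proof.
move=> cf; split; first exact: continuous_meas.
by apply: continuous_intble => x; apply: cvgM; exact: cf.
Qed.

Lemma test_function_continuous phi : test_function phi -> continuous phi.
Proof.
by move=> [d _ _] x; apply/differentiable_continuous/derivable1_diffP.
Qed.

Lemma test_function_ac phi a b : test_function phi -> abs_cont a b phi (derive1 phi).
Proof.
move=> [d c _]; apply: ac_smooth => // t; split; first exact: d.
by rewrite derive1E.
Qed.

Lemma test_function_out phi t : test_function phi -> (t <= 0) || (1 <= t) -> phi t = 0.
Proof.
move=> [_ _ [a [b [a0 b1 ab]]]]; apply: contraTeq => /ab /andP[*].
by rewrite negb_or -!ltNge; apply/andP; split; lra.
Qed.

(** Truncate w and cut it off near 0 and 1, then mollify. *)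
Lemma test_dense w : L2 0 1 w -> forall e, 0 < e ->
  exists2 phi, test_function phi &
    intg 0 1 (fun t => (w t - phi t) ^+ 2) <= e.
Proof.
move=> Lw e e0; have [mw iw2] := Lw.
pose d (n : nat) : R := n.+2%:R^-1.
have d0 n : 0 < d n by rewrite invr_gt0.
(* The truncated function vanishes off A n, hence near 0 and 1. *)
pose A n : set R := `]d n, 1 - d n[%classic `&`
  (`[(0 : R), 1]%classic `&` w @^-1` `[- n%:R, n%:R]%classic).
pose w_ n := w \_ (A n).
have mA n : measurable (A n) by apply: measurableI => //; exact: mw.
have mw_ n : measurable_fun setT (w_ n).
  have sA : A n `<=` `[(0 : R), 1] by move=> t [_ []].
  have mAw : measurable_fun (A n) w by exact: measurable_funS sA mw.
  by have [h _] := measurable_restrictT w (mA n); exact: h mAw.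
have w_E n t : w_ n t = w t \/ w_ n t = 0.
  by rewrite /w_ patchE; case: ifP; [left|right].
have := @L2_dct R 0 1 w_ w (fun t => w t ^+ 2).
case/(_ _ mw _ iw2 _ (e / 4)).
- by move=> n; exact: measurable_funS (mw_ n).
- exists [set 0; 1]; split => //.
  + by apply: measurableU; exact: measurable_set1.
  + by apply: countable_lebesgue_measure0; apply: finite_set_countable.
  + move=> t /= h; apply: contrapT => /not_orP[t0 t1]; apply: h => t01.
  have t2 : 0 < t < 1.
    move: t01; rewrite in_itv /= => /andP[u0 u1].
    by rewrite !lt_neqAle u0 u1 !andbT eq_sym; apply/andP; split; exact/eqP.
  move: t2 {t0 t1} => /andP[t0 t1].
  apply: cvg_near_cst.
  have dc : d @ \oo --> (0 : R).
    by have := @cvg_harmonic R; rewrite -cvg_shiftS.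
  near=> n; rewrite /w_ patchE mem_set//; split.
    rewrite /= in_itv /=; apply/andP; split.
      by near: n; exact: (cvgr_lt 0 dc).
    rewrite ltrBrDr -ltrBrDl; near: n; apply: (cvgr_lt 0 dc); lra.
  split; first by rewrite /= in_itv /=; apply/andP; split; exact: ltW.
  rewrite /= in_itv /= -ler_norml.
  by near: n; exact: nbhs_infty_ger.
- move=> n t _; have [->|->] := w_E n t; last by rewrite subr0.
  by rewrite subrr expr0n sqr_ge0.
- by rewrite divr_gt0.
move=> n _ /(_ n (leqnn n)) h1.
have wb t : `|w_ n t| <= n%:R.
  rewrite /w_ patchE; case: ifP => [|_]; last by rewrite normr0.
  by rewrite inE /A /= !in_itv /= -ler_norml => -[_ []].
have e4 : 0 < e / 4 by rewrite divr_gt0.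
have d12 : 0 < d n <= 1 / 2.
  by rewrite d0 /d div1r lef_pV2 ?posrE// ler_nat.
have ws t : w_ n t != 0 -> d n < t < 1 - d n.
  rewrite /w_ patchE; case: ifP => [|_]; last by rewrite eqxx.
  by rewrite inE /A /= !in_itv /= => -[].
have [phi tphi h2] := bounded_density (mw_ n) wb d12 ws e4.
exists phi => //.
have Lwn : L2 0 1 (w_ n).
  by apply: (@L2_bounded _ _ _ _ n%:R) => // ; exact: measurable_funS (mw_ n).
have Lphi : L2 0 1 phi by apply: continuous_L2; exact: test_function_continuous.
apply: le_trans (L2_triangle Lw Lwn Lphi) _; lra.
Unshelve. all: by end_near. Qed.

Lemma intg0_ae f : L2 0 1 f -> intg 0 1 (fun t => f t ^+ 2) = 0 ->
  {ae mu, forall x, `[(0 : R), 1]%classic x -> f x = 0}.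
Proof.
move=> [mf if2] h.
have m2 : measurable_fun `[(0 : R), 1] (fun t => (f t ^+ 2)%:E).
  exact: measurable_int if2.
have [+ _] := ae_eq_integral_abs mu (measurable_itv `[(0 : R), 1]) m2.
have -> : (\int[mu]_(x in `[0%R, 1%R]) `|(f x ^+ 2)%:E| = 0)%E.
  under eq_integral do rewrite gee0_abs ?lee_fin ?sqr_ge0//.
  by rewrite intgE// h.
move=> /(_ erefl); have FF := ae_filter_ringOfSetsType mu.
apply: filterS => x hx /hx /= /eqP; rewrite eqe sqrf_eq0 => /eqP //.
Qed.

End TestFunctions.

(** * Continuous representatives of elements of H^1(0,1) *)

Section WeakDerivatives.
Context {R : realType}.
Implicit Types (a b c s t x y : R) (f g w phi : R -> R) (u v : H1 R).
Local Notation mu := (@lebesgue_measure R).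

(** A test function close to 1 in mean square has a nonzero integral. *)
Lemma test_function_mass1 : exists2 theta : R -> R, test_function theta &
  intg 0 1 theta = 1.
Proof.
have [phi tphi h] := @test_dense R _ (L2_cst 0 1 1) (1 / 4) ltac:(lra).
have Lphi : L2 0 1 phi by apply: continuous_L2; exact: test_function_continuous.
have p0 : 0 < intg 0 1 phi.
  have : intg 0 1 (fun t => 3 / 4 - phi t) <= intg 0 1 (fun t => (1 - phi t) ^+ 2).
    apply: le_intg => [||t _].
    - by apply: intbleB (intble_cst _ _ _) (L2_intble Lphi).
    - have [_] := L2_lin 1 (-1) (L2_cst 0 1 1) Lphi.
      by apply: eq_intble => t _; ring.
    - have := sqr_ge0 (1 - phi t - 1 / 2); lra.
  rewrite intgB ?intg_cst//; first lra.
  - exact: intble_cst.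
  - exact: L2_intble.
have pn : intg 0 1 phi != 0 by rewrite gt_eqF.
have [dp cp [a [b [a0 b1 ab]]]] := tphi.
pose k := (intg 0 1 phi)^-1.
exists (fun t => k * phi t); last first.
  by rewrite intgZ ?mulVf//; exact: L2_intble.
have dk t : is_derive t 1 (fun t => k * phi t) (k * derive1 phi t).
  have dpt : is_derive t 1 phi (derive1 phi t).
    by split; [exact: dp|rewrite derive1E].
  exact: (is_deriveZ k dpt).
split.
- by move=> t; case: (dk t).
- have -> : derive1 (fun t => k * phi t) = (fun t => k * derive1 phi t).
    by apply/funext => t; rewrite derive1E derive_val.
  by move=> x; apply: cvgM; [exact: cvg_cst|exact: cp].
- exists a, b; split => // t; rewrite mulf_eq0 negb_or => /andP[_].
  exact: ab.
Qed.

(** Subtracting from psi the multiple of a fixed theta of integral 1 with the same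
    integral gives the derivative of a test function. So w - c, with c the
    integral of w theta, is orthogonal to all test functions, which are dense. *)
Lemma du_bois_reymond w : L2 0 1 w ->
  (forall phi, test_function phi ->
    intg 0 1 (fun t => w t * derive1 phi t) = 0) ->
  exists c, {ae mu, forall x, `[(0 : R), 1]%classic x -> w x = c}.
Proof.
move=> Lw hw; have [theta ttheta th1] := test_function_mass1.
have Lth : L2 0 1 theta by apply: continuous_L2; exact: test_function_continuous.
pose c := intg 0 1 (fun t => w t * theta t); exists c.
have key psi : test_function psi ->
    intg 0 1 (fun t => (w t - c) * psi t) = 0.
  move=> tpsi; pose m := intg 0 1 psi.
  have Lpsi : L2 0 1 psi by apply: continuous_L2; exact: test_function_continuous.
  pose eta t := psi t - m * theta t.
  have ceta : continuous eta.
    move=> x; apply: cvgB; first exact: (test_function_continuous tpsi).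
    by apply: cvgM; [exact: cvg_cst|exact: (test_function_continuous ttheta)].
  have [P [P0 dP]] := primitive_exists ceta.
  have hP := ac_smooth 0 1 dP ceta.
  have ieta : intg 0 1 eta = 0.
    rewrite intgB ?intgZ ?th1 ?mulr1 ?subrr//; [exact: L2_intble..|].
    by apply: intbleZ; exact: L2_intble.
  have P1 : P 1 = 0.
    by have := hP.2 0 1 (lexx _) ler01 (lexx _); rewrite ieta P0 subr0.
  have [_ _ [a1 [b1 [a10 b11 ab1]]]] := tpsi.
  have [_ _ [a2 [b2 [a20 b21 ab2]]]] := ttheta.
  (* A compact interval outside which both psi and theta vanish. *)
  pose a := Num.min a1 a2; pose b := Num.max b1 b2.
  have eta0 t : (t < a) || (b < t) -> eta t = 0.
    move=> tab; rewrite /eta.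
    have -> : psi t = 0.
      apply: contraTeq tab => /ab1 /andP[h1 h2].
      by rewrite negb_or -!leNgt /a /b ge_min le_max h1 h2.
    have -> : theta t = 0.
      apply: contraTeq tab => /ab2 /andP[h1 h2].
      by rewrite negb_or -!leNgt /a /b ge_min le_max h1 h2 !orbT.
    by rewrite mulr0 subrr.
  have dPE : derive1 P = eta by apply/funext => t; rewrite derive1E derive_val.
  have tP : test_function P.
    split.
    - by move=> t; case: (dP t).
    - by rewrite dPE.
    - exists a, b; split.
      + by rewrite lt_min a10.
      + by rewrite gt_max b11.
      + have a0 : 0 < a by rewrite lt_min a10.
        have bl1 : b < 1 by rewrite gt_max b11.
        move=> t; apply: contraNT; rewrite negb_and -!ltNge => /orP[ta|bt].
          (* To the left of a, eta vanishes between t and 0, so P t = P 0 = 0. *)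
          have [z [e]] := mean_value_between 0 t dP.
          rewrite le_max => /andP[_ zl].
          have za : z < a by case/orP: zl => zl; lra.
          by move: e; rewrite P0 subr0 eta0 ?za// mul0r => ->.
        have [z [e]] := mean_value_between 1 t dP.
        rewrite ge_min => /andP[zl _].
        have za : b < z by case/orP: zl => zl; lra.
        by move: e; rewrite P1 subr0 eta0 ?za ?orbT// mul0r => ->.
  have := hw _ tP; rewrite dPE.
  have i1 := L2_mul Lw Lpsi; have i2 := L2_mul Lw Lth.
  have -> : intg 0 1 (fun t => w t * eta t) =
      intg 0 1 (fun t => w t * psi t) - m * c.
    rewrite -intgZ// -intgB//; last exact: intbleZ.
    by apply: eq_intg => t _; rewrite /eta; ring.
  have -> : intg 0 1 (fun t => (w t - c) * psi t) =
      intg 0 1 (fun t => w t * psi t) - c * m.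
    rewrite -intgZ; last exact: L2_intble.
    rewrite -intgB//; last by apply: intbleZ; exact: L2_intble.
    by apply: eq_intg => t _; ring.
  by rewrite (mulrC c).
have Lc : L2 0 1 (fun t => w t - c).
  have := L2_lin 1 (-1) Lw (L2_cst 0 1 c).
  by congr L2; apply/funext => t; ring.
have z : intg 0 1 (fun t => (w t - c) ^+ 2) = 0.
  apply/eqP; rewrite eq_le intg_ge0 ?andbT; last by move=> t _; exact: sqr_ge0.
  apply/ler_addgt0Pl => e e0; rewrite addr0.
  have [psi tpsi h] := test_dense Lc e0.
  have Lpsi : L2 0 1 psi by apply: continuous_L2; exact: test_function_continuous.
  apply: le_trans h.
  have [_ ic2] := Lc; have [_ ip2] := Lpsi; have icp := L2_mul Lc Lpsi.
  have e1 : intg 0 1 (fun t => (w t - c - psi t) ^+ 2) =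
     intg 0 1 (fun t => (w t - c) ^+ 2) + intg 0 1 (fun t => psi t ^+ 2).
    rewrite (@eq_intg _ _ _ _ (fun t => (w t - c) ^+ 2 + psi t ^+ 2 +
      -2 * ((w t - c) * psi t))); last by move=> t _; ring.
    rewrite intgD; [|exact: intbleD|exact: intbleZ].
    by rewrite intgZ// (key _ tpsi) mulr0 addr0 intgD.
  by rewrite e1 lerDl; apply: intg_ge0 => t _; exact: sqr_ge0.
have := intg0_ae Lc z; have FF := ae_filter_ringOfSetsType mu.
by apply: filterS => x h /h /eqP; rewrite subr_eq0 => /eqP.
Qed.

Lemma omega_integral f : measurable_fun `[(0 : R), 1] f ->
  (\int[mu]_(t in Omega R) (f t)%:E = \int[mu]_(t in `[0%R, 1%R]) (f t)%:E)%E.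
Proof.
move=> mf; symmetry; apply: integral_itv_bndoo; apply/measurable_EFinP.
apply: measurable_funS mf => // t /=; rewrite !in_itv /= => /andP[/ltW -> /ltW ->] //.
Qed.

Lemma omega_measurable f : measurable_fun (Omega R) f <->
  measurable_fun `[(0 : R), 1] f.
Proof.
by rewrite measurable_fun_itv_bndo_bndcP measurable_fun_itv_obnd_cbndP.
Qed.

Lemma omega_intg f : measurable_fun `[(0 : R), 1] f ->
  \int[mu]_(t in Omega R) f t = intg 0 1 f.
Proof. by move=> mf; rewrite /Rintegral /intg /Rintegral omega_integral. Qed.

Lemma square_integrable_L2 f : square_integrable f <-> L2 0 1 f.
Proof.
split=> [[/omega_measurable mf]|[mf if2]].
  have mf2 : measurable_fun `[(0 : R), 1] (fun t => f t ^+ 2).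
    exact: measurable_funX.
  rewrite omega_integral// => h; split => //.
  apply/integrableP; split; first exact/measurable_EFinP.
  apply: le_lt_trans h; rewrite le_eqVlt; apply/orP; left; apply/eqP.
  by apply: eq_integral => t _ /=; rewrite ger0_norm ?sqr_ge0.
split; first exact/omega_measurable.
rewrite omega_integral; last exact: measurable_funX.
by rewrite intgE// ltry.
Qed.

Lemma H1_fun_in_L2 u : L2 0 1 u.
Proof. exact/square_integrable_L2/H1_fun_L2. Qed.

Lemma H1_deriv_in_L2 u : L2 0 1 (H1_deriv u).
Proof. exact/square_integrable_L2/H1_deriv_L2. Qed.

(** Integration by parts; the boundary terms vanish as phi vanishes at 0 and 1. *)
Lemma ac_test f g phi : abs_cont 0 1 f g -> test_function phi ->
  intg 0 1 (fun t => f t * derive1 phi t) =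
  - intg 0 1 (fun t => g t * phi t).
Proof.
move=> h tphi; have hp := test_function_ac 0 1 tphi.
have [i e] := ac_mul h hp; have := e 0 1 (lexx _) ler01 (lexx _).
rewrite !(test_function_out tphi) ?lexx ?orbT// !mulr0 subrr.
have [K K0 fK] := ac_bounded h; have [C C0 pC] := ac_bounded hp.
have [ig _] := h; have [ip _] := hp.
have i1 : intble 0 1 (fun t => f t * derive1 phi t).
  exact: intbleM (ac_meas h) fK ip.
have i2 : intble 0 1 (fun t => g t * phi t).
  have := intbleM (ac_meas hp) pC ig.
  by apply: eq_intble => t _; rewrite mulrC.
by rewrite intgD// => /eqP; rewrite addrC addr_eq0 => /eqP.
Qed.

(** The primitive of the weak derivative has the same weak derivative as u, hence
    differs from u by a constant. *)
Lemma H1_representative u : exists2 f, abs_cont 0 1 f (H1_deriv u) &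
  {ae mu, forall x, `[(0 : R), 1]%classic x -> u x = f x}.
Proof.
have Lu := H1_fun_in_L2 u; have Lg := H1_deriv_in_L2 u; have ig := L2_intble Lg.
pose f0 t := intg 0 t (H1_deriv u).
have h0 : abs_cont 0 1 f0 (H1_deriv u).
  split => // s t s0 st t1; rewrite /f0 (@intg_cat _ 0 t s) ?s0//.
    by rewrite addrAC subrr add0r.
  exact: intble_sub ig.
have Lf : L2 0 1 f0.
  have [K _ fK] := ac_bounded h0; exact: L2_bounded (ac_meas h0) fK.
pose w t := u t - f0 t.
have Lw : L2 0 1 w.
  have := L2_lin 1 (-1) Lu Lf.
  by congr L2; apply/funext => t; rewrite /w; ring.
have [] := du_bois_reymond Lw.
  move=> phi tphi.
  have Lp : L2 0 1 phi by apply: continuous_L2; exact: test_function_continuous.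
  have Ldp : L2 0 1 (derive1 phi) by apply: continuous_L2; case: tphi.
  have iu := L2_mul Lu Ldp; have i0 := L2_mul Lf Ldp.
  have := H1_derivP u tphi.
  rewrite !omega_intg; [|exact: measurable_funM Lg.1 Lp.1|exact: measurable_funM Lu.1 Ldp.1].
  rewrite -(ac_test h0 tphi) => e.
  rewrite (@eq_intg _ _ _ _ (fun t => u t * derive1 phi t - f0 t * derive1 phi t)).
    by rewrite intgB// e subrr.
  by move=> t _; rewrite /w mulrBl.
move=> c hc; exists (fun t => f0 t + c).
  have [ig0 e0] := h0; split => // s t s0 st t1; rewrite e0//; ring.
have FF := ae_filter_ringOfSetsType mu.
apply: filterS hc => x h /h; rewrite /w => /eqP; rewrite subr_eq => /eqP ->.
by rewrite addrC.
Qed.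

End WeakDerivatives.

(** * Point evaluation as a scalar product of H^1(0,1) *)

Definition concat_at (R : realType) (c : R) (f g : R -> R) (t : R) : R :=
  if t <= c then f t else g t.

Definition represents (R : realType) (f : R -> R) (u : H1 R) : Prop :=
  abs_cont 0 1 f (H1_deriv u) /\
  {ae (@lebesgue_measure R), forall x, `[(0 : R), 1]%classic x -> u x = f x}.

Section Green.
Context {R : realType}.
Implicit Types (a b c s t x y : R) (f g w phi : R -> R) (u v : H1 R).
Local Notation mu := (@lebesgue_measure R).

(** Values at the left end point are irrelevant: this is what allows two functions
    to be concatenated without agreement of their derivatives at the junction. *)
Lemma eq_intble_oc c b f g : (forall t, c < t <= b -> f t = g t) ->
  intble c b f -> intble c b g.
Proof.
move=> fg i.
have io : mu.-integrable `]c, b] (EFin \o g).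
  have : mu.-integrable `]c, b] (EFin \o f).
    by apply: integrableS i => // t /=; rewrite !in_itv /= => /andP[/ltW -> ->].
  by apply: eq_integrable => // t; rewrite inE /= in_itv /= => tcb; rewrite fg.
have [mg fin] := integrableP _ _ _ io.
have mg' : measurable_fun `[c, b] (EFin \o g).
  by apply/measurable_EFinP/measurable_fun_itv_obnd_cbndP/measurable_EFinP.
apply/integrableP; split => //.
rewrite -integral_itv_obnd_cbnd//.
exact: measurableT_comp.
Qed.

Lemma eq_intg_oc c b f g : (forall t, c < t <= b -> f t = g t) ->
  intble c b f -> intg c b f = intg c b g.
Proof.
move=> fg i; have ig := eq_intble_oc fg i.
have sub : `]c, b]%classic `<=` `[c, b]%classic.
  by move=> t /=; rewrite !in_itv /= => /andP[/ltW -> ->].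
rewrite /intg -!(@Rintegral_itv_obnd_cbnd _ c (BRight b)).
- by apply: eq_Rintegral => t; rewrite inE /= in_itv /=; exact: fg.
- exact: integrableS ig.
- exact: integrableS i.
Qed.

Lemma concat_at_left c f g t : t <= c -> concat_at c f g t = f t.
Proof. by rewrite /concat_at => ->. Qed.

Lemma concat_at_right c f g t : c < t -> concat_at c f g t = g t.
Proof. by rewrite /concat_at leNgt => ->. Qed.

Lemma concat_at_intble a b c f g : a <= c <= b -> intble a c f -> intble c b g ->
  intble a b (concat_at c f g).
Proof.
move=> acb i1 i2; apply: (intble_cat acb).
  by apply: eq_intble i1 => t /andP[_ tc]; rewrite concat_at_left.
by apply: eq_intble_oc i2 => t /andP[ct _]; rewrite concat_at_right.
Qed.

Lemma concat_at_intg a b c f g : a <= c <= b -> intble a c f -> intble c b g ->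
  intg a b (concat_at c f g) = intg a c f + intg c b g.
Proof.
move=> acb i1 i2; rewrite (intg_cat acb (concat_at_intble acb i1 i2)).
congr (_ + _).
  by apply: eq_intg => t /andP[_ tc]; rewrite concat_at_left.
by symmetry; apply: eq_intg_oc i2 => t /andP[ct _]; rewrite concat_at_right.
Qed.

Lemma concat_at_ac a b c f g F G : a <= c <= b -> f c = F c ->
  abs_cont a c f g -> abs_cont c b F G ->
  abs_cont a b (concat_at c f F) (concat_at c g G).
Proof.
move=> acb e [ig fg] [iG FG]; split; first exact: concat_at_intble.
move=> s t as_ st tb; have [tc|ct] := leP t c.
  rewrite !concat_at_left//; last exact: le_trans tc.
  rewrite -fg//; apply: eq_intg => r /andP[_ rt]; rewrite concat_at_left//.
  exact: le_trans tc.
have [sc|cs] := leP s c.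
  rewrite concat_at_intg ?sc ?(ltW ct)//; last 2 first.
  - apply: intble_sub ig => //.
  - apply: intble_sub iG => //.
  rewrite fg// FG// ?(ltW ct)// (concat_at_left f F sc) (concat_at_right f F ct) e; ring.
rewrite !concat_at_right// -FG// ?(ltW cs)//.
apply: eq_intg => r /andP[sr _]; rewrite concat_at_right//.
exact: lt_le_trans sr.
Qed.

Lemma H1_of_ac f g : abs_cont 0 1 f g -> L2 0 1 g ->
  exists2 u : H1 R, H1_fun u = f & H1_deriv u = g.
Proof.
move=> h Lg.
have Lf : L2 0 1 f.
  by have [K _ fK] := ac_bounded h; exact: L2_bounded (ac_meas h) fK.
have w : is_weak_derivative f g.
  move=> phi tphi.
  have Lp : L2 0 1 phi by apply: continuous_L2; exact: test_function_continuous.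
  have Ldp : L2 0 1 (derive1 phi) by apply: continuous_L2; case: tphi.
  rewrite !omega_intg; [exact: ac_test|exact: measurable_funM Lg.1 Lp.1|
    exact: measurable_funM Lf.1 Ldp.1].
by exists (MkH1 ((square_integrable_L2 f).2 Lf) ((square_integrable_L2 g).2 Lg) w).
Qed.

Lemma represents_refl u g : abs_cont 0 1 u g -> H1_deriv u = g ->
  represents u u.
Proof. by move=> h e; split; [rewrite e|apply: aeW]. Qed.

Lemma represents_L2 f u : represents f u -> L2 0 1 f.
Proof.
move=> [h _]; have [K _ fK] := ac_bounded h; exact: L2_bounded (ac_meas h) fK.
Qed.

Lemma represents_inner f u v : represents f u ->
  H1_inner u v =
  intg 0 1 (fun t => f t * v t) + intg 0 1 (fun t => H1_deriv u t * H1_deriv v t).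
Proof.
move=> h; have Lf := represents_L2 h; have Lu := H1_fun_in_L2 u.
have Lv := H1_fun_in_L2 v.
rewrite /H1_inner !omega_intg; last 2 first.
- exact: measurable_funM (H1_deriv_in_L2 u).1 (H1_deriv_in_L2 v).1.
- exact: measurable_funM Lu.1 Lv.1.
congr (_ + _); rewrite /intg /Rintegral; congr fine; apply: ae_eq_integral => //.
- by apply/measurable_EFinP; exact: measurable_funM Lu.1 Lv.1.
- by apply/measurable_EFinP; exact: measurable_funM Lf.1 Lv.1.
- have FF := ae_filter_ringOfSetsType mu.
  by apply: filterS h.2 => x hx /hx ->.
Qed.

(** The representative k solves k'' = k away from t, has zero derivative at 0 and
    1, and its derivative jumps by -1 at t: integrate by parts on both sides. *)
Lemma evaluation_riesz t : 0 <= t <= 1 -> exists k : H1 R,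
  forall f u, represents f u -> H1_inner u k = f t.
Proof.
move=> /andP[t0 t1].
pose C (s : R) := expR s + expR (- s); pose S (s : R) := expR s - expR (- s).
have dC s : is_derive s 1 C (S s).
  by apply: is_derive_eq; rewrite /GRing.scale /= /S; ring.
have dS s : is_derive s 1 S (C s).
  by apply: is_derive_eq; rewrite /GRing.scale /= /C; ring.
have dC1 s : is_derive s 1 (fun s => C (1 - s)) (- S (1 - s)).
  by apply: is_derive_eq; rewrite /GRing.scale /= /S; ring.
have dS1 s : is_derive s 1 (fun s => S (1 - s)) (- C (1 - s)).
  by apply: is_derive_eq; rewrite /GRing.scale /= /C; ring.
have cont f g : (forall s, is_derive s 1 f (g s)) -> continuous f.
  by move=> df x; apply/differentiable_continuous/derivable1_diffP.
have cC := cont _ _ dC; have cS := cont _ _ dS.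
have cC1 := cont _ _ dC1; have cS1 := cont _ _ dS1.
have S1 : 0 < S 1 by rewrite /S subr_gt0 ltr_expR; lra.
pose D := 2 * S 1; pose A := C (1 - t) / D; pose B := C t / D.
have D0 : D != 0 by rewrite gt_eqF// mulr_gt0.
(* The jump of the derivative of the kernel at t is normalized to 1. *)
have wronskian : A * S t + B * S (1 - t) = 1.
  rewrite /A /B; apply: (mulfI D0); rewrite mulr1.
  transitivity (C (1 - t) * S t + C t * S (1 - t)); first by field.
  rewrite /D /C /S opprB !expRD !expRN; field.
  by rewrite !gt_eqF ?expR_gt0.
have scal (k : R) (h h' : R -> R) : 
    (forall s, is_derive s 1 h (h' s)) ->
    forall s, is_derive s 1 (fun s => k * h s) (k * h' s).
  by move=> dh s; have := dh s => dhs; exact: (is_deriveZ k dhs).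
have cM (k : R) (h : R -> R) : continuous h -> continuous (fun s => k * h s).
  by move=> ch x; apply: cvgM; [exact: cvg_cst|exact: ch].
have a1 a b : abs_cont a b (fun s => A * C s) (fun s => A * S s).
  by apply: ac_smooth (scal A _ _ _) (cM A _ _).
have a2 a b : abs_cont a b (fun s => A * S s) (fun s => A * C s).
  by apply: ac_smooth (scal A _ _ _) (cM A _ _).
have a3 a b : abs_cont a b (fun s => B * C (1 - s)) (fun s => - B * S (1 - s)).
  apply: ac_smooth => [s|]; last exact: cM.
  by move: s => s; rewrite mulNr -mulrN; exact: scal.
have a4 a b : abs_cont a b (fun s => - B * S (1 - s)) (fun s => B * C (1 - s)).
  apply: ac_smooth => [s|]; last exact: cM.
  by move: s => s; have := scal (- B) _ _ dS1 s; rewrite mulrNN.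
have t01 : 0 <= t <= 1 by rewrite t0.
have hk := concat_at_ac t01 (_ : A * C t = B * C (1 - t)) (a1 0 t) (a3 t 1).
have {}hk := hk ltac:(by rewrite /A /B; field).
have Lk' : L2 0 1 (concat_at t (fun s => A * S s) (fun s => - B * S (1 - s))).
  have m : measurable_fun `[(0 : R), 1]
      (concat_at t (fun s => A * S s) (fun s => - B * S (1 - s))).
    by apply: intble_meas; case: hk.
  have [K1 _ b1] := ac_bounded (a2 0 t); have [K2 _ b2] := ac_bounded (a4 t 1).
  apply: (@L2_bounded _ _ _ _ (Num.max K1 K2)) => // s /andP[s0 s1].
  rewrite le_max; have [st|ts] := leP s t.
    by rewrite concat_at_left// b1 ?s0.
  by rewrite concat_at_right// b2 ?s1 ?(ltW ts)// orbT.
have [k ek ek'] := H1_of_ac hk Lk'; exists k => f u hu.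
rewrite (represents_inner k hu).
have [hf _] := hu; have Lf := represents_L2 hu.
have i1 : intble 0 1 (fun t => f t * k t) := L2_mul Lf (H1_fun_in_L2 k).
have i2 := L2_mul (H1_deriv_in_L2 u) (H1_deriv_in_L2 k).
rewrite -intgD// (intg_cat t01); last exact: intbleD.
have [_ e1] := ac_mul (ac_sub (lexx 0) t1 hf) (a2 0 t).
have [_ e2] := ac_mul (ac_sub t0 (lexx 1) hf) (a4 t 1).
have E1 : intg 0 t (fun s => f s * k s + H1_deriv u s * H1_deriv k s) =
    f t * (A * S t).
  have S0 : S 0 = 0 by rewrite /S oppr0 subrr.
  have := e1 0 t (lexx _) t0 (lexx _); rewrite S0 !mulr0 subr0 => <-.
  apply: eq_intg => s /andP[_ st].
  by rewrite ek ek' !concat_at_left// addrC.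
have E2 : intg t 1 (fun s => f s * k s + H1_deriv u s * H1_deriv k s) =
    f t * (B * S (1 - t)).
  have S0 : S (1 - 1) = 0 by rewrite subrr /S oppr0 subrr.
  have := e2 t 1 (lexx _) t1 (lexx _); rewrite S0 !mulr0 sub0r => e3.
  transitivity (- (f t * (- B * S (1 - t)))); last by ring.
  rewrite -e3.
  apply: eq_intg_oc.
    by move=> s /andP[ts _]; rewrite ek ek' !concat_at_right// addrC.
  by apply: intble_sub (intbleD i1 i2).
by rewrite E1 E2 -mulrDr wronskian mulr1.
Qed.

(** Test the weak convergence against the kernel of the evaluation at t. *)
Lemma weakly_cvg_pointwise (u_ : R -> H1 R) u (f_ : R -> R -> R) f :
  weakly_cvg u_ u -> (forall e, represents (f_ e) (u_ e)) -> represents f u ->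
  forall t, 0 <= t <= 1 -> f_ e t @[e --> 0^'+] --> f t.
Proof.
move=> wc hf_ hf t t01; have [k hk] := evaluation_riesz t01.
have := wc k; rewrite (hk _ _ hf).
by under eq_fun do rewrite (hk _ _ (hf_ _)).
Qed.

End Green.

(** * Lower bound by completing the square *)

Section LowerBound.
Context {R : realType}.
Implicit Types (a b c s t x y eps : R) (f g w phi V : R -> R) (u v : H1 R).
Local Notation mu := (@lebesgue_measure R).

Lemma periodic_reduce y : exists2 z : R, 0 <= z <= 1 &
  forall P : R -> R, (forall s, P (s + 1) = P s) -> P y = P z.
Proof.
have per (P : R -> R) : (forall s, P (s + 1) = P s) ->
    forall n z, P (z + n%:R) = P z.
  move=> hP n z; elim: n => [|n IH]; first by rewrite addr0.
  by rewrite -addn1 natrD addrA hP.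
have [y0|/ltW y0] := leP 0 y.
  exists (y - (Num.truncn y)%:R); last first.
    by move=> P hP; rewrite -[in RHS](per P hP (Num.truncn y)) subrK.
  have /andP[h1 h2] := truncn_itv y0.
  move: h2; rewrite -addn1 natrD => h2; lra.
have y1 : 0 <= - y by lra.
exists (y + (Num.truncn (- y)).+1%:R); last first.
  by move=> P hP; rewrite per.
have /andP[h1 h2] := truncn_itv y1.
move: h2; rewrite -addn1 natrD => h2; lra.
Qed.

Lemma continuous_bounded_segment f a b : continuous f ->
  exists2 K, 0 < K & forall t, a <= t <= b -> `|f t| <= K.
Proof.
move=> cf; have [C [_ hC]] := compact_bounded (continuous_compact
  (continuous_subspaceT cf) (@segment_compact R a b)).
exists (`|C| + 1) => [|t tab]; first by rewrite ltr_wpDl.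
apply: hC; first by rewrite (le_lt_trans (ler_norm _))// ltrDl.
by exists t => //=; rewrite in_itv.
Qed.

Lemma periodic_bounded V : continuous V -> (forall s, V (s + 1) = V s) ->
  exists2 K, 0 < K & forall s, `|V s| <= K.
Proof.
move=> cV pV; have [K K0 hK] := continuous_bounded_segment 0 1 cV.
by exists K => // s; have [z z01 ->] := periodic_reduce s; [exact: hK|exact: pV].
Qed.

Lemma periodic_pos V : continuous V -> (forall s, V (s + 1) = V s) ->
  (forall s, 0 < V s) -> exists2 k, 0 < k & forall s, k <= V s.
Proof.
move=> cV pV V0.
have [c c01 hc] := EVT_min (@ler01 R) (continuous_subspaceT cV).
exists (V c) => // s; have [z z01 ->] := periodic_reduce s; last exact: pV.
by apply: hc; rewrite in_itv.
Qed.

(** The function Phi(y) - M y, with M the mean of phi, is periodic, hence bounded;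
    after scaling the error is of order eps. *)
Lemma primitive_periodic phi Phi : continuous phi ->
  (forall s, phi (s + 1) = phi s) -> (forall s, is_derive s 1 Phi (phi s)) ->
  exists2 K, 0 < K & forall eps a b, 0 < eps ->
   `|eps * (Phi (a / eps) - Phi (b / eps)) - intg 0 1 phi * (a - b)| <= eps * K.
Proof.
move=> cphi pphi dPhi; set M := intg 0 1 phi.
have cPhi : continuous Phi.
  by move=> x; apply/differentiable_continuous/derivable1_diffP.
pose P s := Phi s - M * s.
have dshift (s : R) : is_derive s 1 (fun s => Phi (s + 1) - Phi s) 0.
  have dsh : is_derive s 1 (fun t => t + 1 : R) (1 + 0) by apply: is_deriveD.
  rewrite addr0 in dsh.
  have := is_deriveB (@is_derive1_comp R Phi (fun t => t + 1) s _ _ (dPhi (s + 1)) dsh)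
    (dPhi s).
  by rewrite mulr1 pphi subrr.
have hM : M = Phi 1 - Phi 0.
  by rewrite /M (ac_smooth 0 1 dPhi cphi).2.
have pP s : P (s + 1) = P s.
  have [z [e _]] := mean_value_between 0 s dshift.
  move: e; rewrite mul0r add0r => /eqP; rewrite subr_eq0 -hM => /eqP e.
  rewrite /P; lra.
have cP : continuous P.
  by move=> x; apply: cvgB; [exact: cPhi|apply: cvgM; [exact: cvg_cst|exact: cvg_id]].
have [K K0 hK] := periodic_bounded cP pP.
exists (2 * K) => [|eps a b e0]; first by rewrite mulr_gt0.
have -> : eps * (Phi (a / eps) - Phi (b / eps)) - M * (a - b) =
    eps * (P (a / eps) - P (b / eps)).
  by rewrite /P; field; rewrite gt_eqF.
rewrite normrM (gtr0_norm e0); apply: ler_wpM2l; first exact: ltW.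
by apply: le_trans (ler_normB _ _) _; have := hK (a / eps); have := hK (b / eps); lra.
Qed.

Lemma scaled_primitive Phi phi eps : 0 < eps ->
  (forall s, is_derive s 1 Phi (phi s)) ->
  forall s, is_derive s 1 (fun s => eps * Phi (s / eps)) (phi (s / eps)).
Proof.
move=> e0 dPhi s.
have dsh : is_derive s 1 (fun t => eps^-1 * t : R) (eps^-1 * 1).
  exact: (is_deriveZ eps^-1 (is_derive_id s 1)).
have dP : is_derive (eps^-1 * s) 1 Phi (phi (s / eps)) by rewrite mulrC.
have := is_deriveZ eps (is_derive1_comp dP dsh).
have -> : eps *: (phi (s / eps) * (eps^-1 * 1)) = phi (s / eps).
  by rewrite /GRing.scale /=; field; rewrite gt_eqF.
set A := (X in is_derive _ _ X _ -> _).
by congr is_derive; apply/funext => x; rewrite /A /= /GRing.scale /= (mulrC x).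
Qed.

Lemma continuous_sqrt f : continuous f -> continuous (fun x => Num.sqrt (f x)).
Proof.
move=> cf x; apply: (@continuous_comp _ _ _ f Num.sqrt); first exact: cf.
exact: sqrt_continuous.
Qed.

Lemma continuous_sqrt_shift U b : continuous U ->
  continuous (fun s => Num.sqrt (U s + b)).
Proof.
move=> cU; apply: continuous_sqrt => x.
by apply: (@continuousD _ _ _ U (fun=> b)); [exact: cU|exact: cst_continuous].
Qed.

Lemma continuous_scaled eps f : continuous f -> continuous (fun x => f (x / eps)).
Proof.
move=> cf x; apply: (@continuous_comp _ _ _ (fun x => x / eps) f).
  by apply: cvgM; [exact: cvg_id|exact: cvg_cst].
exact: cf.
Qed.

Lemma energy_density_intble a b V f g eps : continuous V ->
  (forall s, V (s + 1) = V s) -> abs_cont a b f g -> L2 a b g ->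
  intble a b (fun t => g t ^+ 2 + V (f t / eps)).
Proof.
move=> cV pV hf [mg ig2]; apply: intbleD => //.
have [K K0 hK] := periodic_bounded cV pV.
apply: (@bounded_intble _ _ _ _ K) => // .
have mf := ac_meas hf.
apply: (@measurableT_comp _ _ _ _ _ _ V).
  exact: continuous_measurable_fun.
by apply: measurable_funM => //; exact: measurable_cst.
Qed.

(** The inequality (sqrt(V + c) - |g|)^2 >= 0 combined with the chain rule for a
    primitive of sqrt(V + c). *)
Lemma modica_mortola a b V f g eps c Phi : continuous V ->
  (forall s, V (s + 1) = V s) -> (forall s, 0 < V s + c) -> 0 < eps -> a <= b ->
  (forall s, is_derive s 1 Phi (Num.sqrt (V s + c))) ->
  abs_cont a b f g -> L2 a b g ->
  2 * `|eps * (Phi (f b / eps) - Phi (f a / eps))| - c * (b - a) <=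
  intg a b (fun t => g t ^+ 2 + V (f t / eps)).
Proof.
move=> cV pV Vc e0 ab dPhi hf Lg.
pose psi (x : R) := Num.sqrt (V (x / eps) + c).
have dPsi := scaled_primitive e0 dPhi.
have cpsi : continuous psi.
  have cVe : continuous (fun x => V (x / eps)) := @continuous_scaled eps V cV.
  exact: continuous_sqrt_shift.
have [i1 e1] := ac_chain hf dPsi cpsi.
have := e1 a b (lexx _) ab (lexx _); rewrite /= -mulrBr => <-.
have ie := energy_density_intble eps cV pV hf Lg.
rewrite lerBlDr -intg_cst// -intgD//; last exact: intble_cst.
apply: le_trans (_ : 2 * intg a b (fun t => `|psi (f t) * g t|) <= _).
  by rewrite ler_wpM2l//; exact: intg_norm.
rewrite -intgZ; last exact: intble_norm.
apply: le_intg => [||t _].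
- exact/intbleZ/intble_norm.
- by apply: intbleD => //; exact: intble_cst.
- have p2 : psi (f t) ^+ 2 = V (f t / eps) + c by rewrite sqr_sqrtr// ltW.
  have g2 : `|g t| ^+ 2 = g t ^+ 2 by rewrite real_normK ?num_real.
  rewrite normrM (ger0_norm (sqrtr_ge0 _)) -/(psi (f t)).
  have := sqr_ge0 (psi (f t) - `|g t|); rewrite sqrrB p2 g2; lra.
Qed.

Lemma intg_mesh (h : R -> R) (N k : nat) : (0 < N)%N -> (k <= N)%N ->
  intble 0 1 h ->
  intg 0 (k%:R / N%:R) h = \sum_(i < k) intg (i%:R / N%:R) (i.+1%:R / N%:R) h.
Proof.
move=> N0 + ih; elim: k => [|k IH] kN; first by rewrite mul0r intg_pt big_ord0.
have NR : 0 < N%:R :> R by rewrite ltr0n.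
rewrite big_ord_recr /= -IH; last exact: ltnW.
apply: intg_cat; first by rewrite divr_ge0//= ler_pM2r ?invr_gt0// ler_nat.
apply: intble_sub ih => //.
by rewrite ler_pdivrMr// mul1r ler_nat.
Qed.

Lemma F_energy_intg V eps f u : continuous V -> (forall s, V (s + 1) = V s) ->
  represents f u ->
  F_energy V eps u =
    (intg 0 1 (fun t => H1_deriv u t ^+ 2 + V (f t / eps)))%:E.
Proof.
move=> cV pV hf; have Lg := H1_deriv_in_L2 u; have Lu := H1_fun_in_L2 u.
have i := energy_density_intble eps cV pV hf.1 Lg.
have m : measurable_fun `[(0 : R), 1] (fun t => `|H1_deriv u t| ^+ 2 + V (u t / eps)).
  apply: measurable_funD.
    by apply: measurable_funX; apply: measurableT_comp => //; case: Lg.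
  apply: (@measurableT_comp _ _ _ _ _ _ V); first exact: continuous_measurable_fun.
  by apply: measurable_funM; [case: Lu|exact: measurable_cst].
rewrite /F_energy omega_integral// -intgE//.
apply: ae_eq_integral => //.
- exact/measurable_EFinP.
- exact: measurable_int i.
- have FF := ae_filter_ringOfSetsType mu.
  by apply: filterS hf.2 => x hx /hx ->; rewrite real_normK ?num_real.
Qed.

End LowerBound.

(** * The limit functional and the lower limit inequality *)

(** The slope of the limit of the rescaled primitives of sqrt(V + c). *)
Definition level_speed (R : realType) (V : R -> R) (c : R) : R :=
  intg 0 1 (fun s => Num.sqrt (V s + c)).

Definition dual_sum (R : realType) (V : R -> R) (N : nat) (c : nat -> R)
    (f : R -> R) : R :=
  \sum_(i < N) (2 * (level_speed V (c i) *
    `|f (i.+1%:R / N%:R) - f (i%:R / N%:R)|) - c i / N%:R).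

(** Equivalently, the integral of f_hom(u') with f_hom(xi) the supremum over c of
    2 |xi| M(c) - c; the discrete form needs no integral of f_hom and is exactly
    what the two inequalities produce. All representatives of u agree on [0, 1],
    so that quantifying over f inside the set is harmless. *)
Definition Gamma_energy (R : realType) (V : R -> R) (u : H1 R) : \bar R :=
  ereal_sup [set x | exists (N : nat) (c : nat -> R) (f : R -> R),
    [/\ (0 < N)%N, forall i s, 0 < V s + c i, represents f u &
        x = (dual_sum V N c f)%:E] ].

Section Liminf.
Context {R : realType}.
Implicit Types (a b c s t x y eps : R) (f g w phi V W : R -> R) (u v : H1 R).
Local Notation mu := (@lebesgue_measure R).

Lemma cvg_sum_ord (F : set_system R) (FF : Filter F) (N : nat)
    (h : nat -> R -> R) (l : nat -> R) :
  (forall i, (i < N)%N -> h i e @[e --> F] --> l i) ->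
  (\sum_(i < N) h i e) @[e --> F] --> \sum_(i < N) l i.
Proof.
elim: N => [|N IH] H.
  rewrite big_ord0; under eq_fun do rewrite big_ord0; exact: cvg_cst.
rewrite big_ord_recr; under eq_fun do rewrite big_ord_recr /=.
by apply: cvgD; [apply: IH => i iN; apply: H; exact: ltnW|exact: H].
Qed.

Lemma le_limf_einf_of_near (h : R -> \bar R) (S : R) :
  (forall d, 0 < d -> \forall e \near (0 : R)^'+, ((S - d)%:E <= h e)%E) ->
  (S%:E <= limf_einf h (0 : R)^'+)%E.
Proof.
move=> H; apply/lee_addgt0Pr => d d0; rewrite -leeBlDr// -EFinB.
rewrite limf_einfE; apply: le_ereal_sup_tmp.
exists (ereal_inf (h @` [set e | ((S - d)%:E <= h e)%E])).
  by exists [set e | ((S - d)%:E <= h e)%E] => //; exact: H.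
by apply: le_ereal_inf_tmp => x [e /= he <-].
Qed.

Lemma represents_choice (u_ : R -> H1 R) : exists f_ : R -> R -> R,
  forall e, represents (f_ e) (u_ e).
Proof.
have : forall e, exists f, represents f (u_ e).
  by move=> e; have [f h1 h2] := H1_representative (u_ e); exists f.
by move=> /choice[f_ hf_]; exists f_.
Qed.

Lemma F_energy_liminf V (u : H1 R) (u_ : R -> H1 R) : continuous V ->
  (forall s, V (s + 1) = V s) -> weakly_cvg u_ u ->
  (Gamma_energy V u <= limf_einf (fun eps => F_energy V eps (u_ eps)) (0 : R)^'+)%E.
Proof.
move=> cV pV wc; apply: ge_ereal_sup => _ [N [c [f [N0 Vc hf ->]]]].
have [f_ hf_] := represents_choice u_.
have pw := weakly_cvg_pointwise wc hf_ hf.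
apply: le_limf_einf_of_near => d d0.
have cphi i : continuous (fun s => Num.sqrt (V s + c i)).
  exact: continuous_sqrt_shift.
have pphi i s : Num.sqrt (V (s + 1) + c i) = Num.sqrt (V s + c i) by rewrite pV.
have /choice[Phi dPhi] : forall i, exists P : R -> R,
    forall s, is_derive s 1 P (Num.sqrt (V s + c i)).
  by move=> i; have [P [_ dP]] := primitive_exists (cphi i); exists P.
have /choice[K hK] : forall i, exists K, 0 < K /\ forall eps a b, 0 < eps ->
   `|eps * (Phi i (a / eps) - Phi i (b / eps)) - level_speed V (c i) * (a - b)|
     <= eps * K.
  move=> i; have [K K0 h] := primitive_periodic (cphi i) (pphi i) (dPhi i).
  by exists K.
pose t_ (i : nat) : R := i%:R / N%:R.
have NR : 0 < N%:R :> R by rewrite ltr0n.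
have t01 i : (i <= N)%N -> 0 <= t_ i <= 1.
  move=> iN; rewrite divr_ge0//= ler_pdivrMr// mul1r ler_nat//.
pose T e := \sum_(i < N) (2 * (level_speed V (c i) *
  `|f_ e (t_ i.+1) - f_ e (t_ i)| - e * K i) - c i / N%:R).
have cT : T e @[e --> (0 : R)^'+] --> dual_sum V N c f.
  apply: (@cvg_sum_ord _ _ N (fun i e => 2 * (level_speed V (c i) *
    `|f_ e (t_ i.+1) - f_ e (t_ i)| - e * K i) - c i / N%:R)
    (fun i => 2 * (level_speed V (c i) * `|f (t_ i.+1) - f (t_ i)|) -
       c i / N%:R)) => i iN.
  apply: cvgB; last exact: cvg_cst.
  apply: cvgM; first exact: cvg_cst.
  rewrite -[X in _ --> X]subr0; apply: cvgB.
    apply: cvgM; first exact: cvg_cst.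
    by apply: cvg_norm; apply: cvgB; apply: pw; apply: t01 => //; exact: ltnW.
  rewrite -[X in _ --> X](mul0r (K i)); apply: cvgM; last exact: cvg_cst.
  by apply: cvg_at_right_filter; exact: cvg_id.
have : \forall e \near (0 : R)^'+, dual_sum V N c f - d < T e.
  by apply: (cvgr_gt _ cT); rewrite ltrBlDr ltrDl.
have : \forall e \near (0 : R)^'+, 0 < e by exact: nbhs_right_gt.
apply: filterS2 => e e0 hT.
rewrite (F_energy_intg e cV pV (hf_ e)) lee_fin; apply: le_trans (ltW hT) _.
have hg := H1_deriv_in_L2 (u_ e).
have ie := energy_density_intble e cV pV (hf_ e).1 hg.
have := intg_mesh N0 (leqnn N) ie; rewrite divff ?gt_eqF// => ->.
apply: ler_sum => i _.
have h1 : t_ i.+1 <= 1 by have /andP[] := t01 i.+1 (ltn_ord i).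
have h0 : 0 <= t_ i by have /andP[] := t01 i (ltnW (ltn_ord i)).
have h2 : t_ i <= t_ i.+1 by rewrite ler_pM2r ?invr_gt0// ler_nat.
have hs : t_ i.+1 - t_ i = N%:R^-1.
  by rewrite /t_ -mulrBl -natrB// subSnn mul1r.
have Lg : L2 (t_ i) (t_ i.+1) (H1_deriv (u_ e)).
  split; last exact: intble_sub hg.2.
  apply: measurable_funS hg.1 => // x /=; rewrite !in_itv /=; lra.
apply: le_trans (modica_mortola cV pV (Vc i) e0 h2 (dPhi i)
   (ac_sub h0 h1 (hf_ e).1) Lg).
rewrite hs lerD2r ler_pM2l// lerBlDr.
have [_ hKi] := hK i; have := hKi e (f_ e (t_ i.+1)) (f_ e (t_ i)) e0.
set X := e * _; set Y := level_speed _ _ * _ => XY.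
have M0 : 0 <= level_speed V (c i) by apply: intg_ge0 => s _; exact: sqrtr_ge0.
have -> : level_speed V (c i) * `|f_ e (t_ i.+1) - f_ e (t_ i)| = `|Y|.
  by rewrite /Y normrM (ger0_norm M0).
have -> : Y = X - (X - Y) by ring.
by apply: le_trans (ler_normB _ _) _; rewrite lerD2l.
Qed.

(** The integral of W(u/eps) may be infinite, so the positive and negative parts are
    compared separately. *)
Lemma F_energy_le_G_energy V W eps (u : H1 R) : continuous V ->
  (forall s, V (s + 1) = V s) -> measurable_fun [set: R] W ->
  (forall s, 0 <= W s) -> (F_energy V eps u <= G_energy V W eps u)%E.
Proof.
move=> cV pV mW W0; rewrite /F_energy /G_energy.
have Lg := H1_deriv_in_L2 u; have Lu := H1_fun_in_L2 u.
have mo f : measurable_fun `[(0 : R), 1] f -> measurable_fun (Omega R) f.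
  by move=> /omega_measurable.
have mu_ : measurable_fun `[(0 : R), 1] (fun t => u t / eps).
  by apply: measurable_funM; [case: Lu|exact: measurable_cst].
have mF : measurable_fun `[(0 : R), 1] (fun t => `|H1_deriv u t| ^+ 2 + V (u t / eps)).
  apply: measurable_funD.
    by apply: measurable_funX; apply: measurableT_comp => //; case: Lg.
  by apply: (@measurableT_comp _ _ _ _ _ _ V) => //; exact: continuous_measurable_fun.
have mG : measurable_fun `[(0 : R), 1]
    (fun t => `|H1_deriv u t| ^+ 2 + V (u t / eps) + W (u t / eps)).
  by apply: measurable_funD => //; apply: (@measurableT_comp _ _ _ _ _ _ W).
pose f t := (`|H1_deriv u t| ^+ 2 + V (u t / eps))%:E.
pose g t := (`|H1_deriv u t| ^+ 2 + V (u t / eps) + W (u t / eps))%:E.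
rewrite -[X in (X <= _)%E]/(\int[mu]_(t in Omega R) f t)%E
  -[X in (_ <= X)%E]/(\int[mu]_(t in Omega R) g t)%E.
have mf : measurable_fun (Omega R) f by apply/measurable_EFinP; exact: mo mF.
have mg : measurable_fun (Omega R) g by apply/measurable_EFinP; exact: mo mG.
have mO : measurable (Omega R) by exact: measurable_itv.
have fg t : (f t <= g t)%E by rewrite lee_fin lerDl.
rewrite (integralE mu (Omega R) f) (integralE mu (Omega R) g); apply: leeB.
  apply: (@ge0_le_integral _ _ R mu (Omega R) mO (f^\+)%E (g^\+)%E).
  - by move=> t _; exact: funepos_ge0.
  - exact: measurable_funepos.
  - exact: measurable_funepos.
  - by move=> t _; rewrite !funeposE ge_max !le_max fg lexx orbT.
apply: (@ge0_le_integral _ _ R mu (Omega R) mO (g^\-)%E (f^\-)%E).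
- by move=> t _; exact: funeneg_ge0.
- exact: measurable_funeneg.
- exact: measurable_funeneg.
- by move=> t _; rewrite !funenegE ge_max !le_max leeN2 fg lexx orbT.
Qed.

Lemma limf_einf_homo (h k : R -> \bar R) : (forall e, (h e <= k e)%E) ->
  (limf_einf h (0 : R)^'+ <= limf_einf k (0 : R)^'+)%E.
Proof.
move=> hk; rewrite !limf_einfE; apply: ge_ereal_sup => _ [A FA <-].
apply: le_ereal_sup_tmp; exists (ereal_inf (k @` A)); first by exists A.
apply: le_ereal_inf_tmp => x [e Ae <-].
by apply: le_trans (hk e); apply: ereal_inf_lbound; exists e.
Qed.

End Liminf.

(** * The cell problem *)

(** The limit energy per unit of time of a path with mean slope xi whose speed is
    proportional to 1 / q(u/eps); it is invariant under scaling of q. *)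
Definition cell_cost (R : realType) (V : R -> R) (xi : R) (q : R -> R) : R :=
  xi ^+ 2 * intg 0 1 q * intg 0 1 (fun s => (q s)^-1) +
  intg 0 1 (fun s => V s * q s) / intg 0 1 q.

Section Cell.
Context {R : realType}.
Implicit Types (a b c s t x y eps xi : R) (f g w phi V W U q : R -> R).
Local Notation mu := (@lebesgue_measure R).

Lemma le_intg_sub a b s t f : a <= s -> s <= t -> t <= b -> intble a b f ->
  (forall x, a <= x <= b -> 0 <= f x) -> intg s t f <= intg a b f.
Proof.
move=> as_ st tb i f0.
have ast : a <= s <= b by rewrite as_ (le_trans st).
have stb : s <= t <= b by rewrite st.
rewrite (intg_cat ast i) (intg_cat stb (intble_sub as_ (lexx b) i)).
have h1 : 0 <= intg a s f.
  by apply: intg_ge0 => x /andP[? ?]; apply: f0; apply/andP; split; lra.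
have h2 : 0 <= intg t b f.
  by apply: intg_ge0 => x /andP[? ?]; apply: f0; apply/andP; split; lra.
lra.
Qed.

(** The integrand equals 1 / sqrt b on the interval where U vanishes. *)
Lemma wait_time_large U : continuous U -> (forall s, 0 <= U s) ->
  (exists p p', [/\ 0 <= p, p < p', p' <= 1 & forall s, p <= s <= p' -> U s = 0]) ->
  forall L, exists2 b, 0 < b <= 1 &
    L <= intg 0 1 (fun s => (Num.sqrt (U s + b))^-1).
Proof.
move=> cU U0 [p [p' [p0 pp p1 Up]]] L.
pose L1 := Num.max L 1; pose r := (p' - p) / L1.
have L10 : 0 < L1 by rewrite lt_max ltr01 orbT.
have L11 : 1 <= L1 by rewrite le_max lexx orbT.
have r0 : 0 < r by rewrite divr_gt0// subr_gt0.
have r1 : r <= 1 by rewrite ler_pdivrMr// mul1r; lra.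
exists (r ^+ 2); first by rewrite exprn_gt0//= expr_le1// ltW.
have b0 : 0 < r ^+ 2 by rewrite exprn_gt0.
have sp s : 0 < Num.sqrt (U s + r ^+ 2) by rewrite sqrtr_gt0 ltr_wpDl.
have cq : continuous (fun s => (Num.sqrt (U s + r ^+ 2))^-1).
  apply: continuous_inv => [|s]; last by rewrite gt_eqF.
  exact: continuous_sqrt_shift.
apply: le_trans (le_intg_sub p0 (ltW pp) p1 (continuous_intble 0 1 cq) _); last first.
  by move=> x _; rewrite invr_ge0 ltW.
rewrite (@eq_intg _ _ _ _ (fun=> r^-1)); last first.
  by move=> s sp'; rewrite (Up _ sp') add0r sqrtr_sqr gtr0_norm.
rewrite intg_cst ?(ltW pp)// /r invf_div divfK ?gt_eqF ?subr_gt0//.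
by rewrite le_max lexx.
Qed.

(** The left-hand side depends continuously on b, is large for small b by the
    previous lemma, and is at most 1 / sqrt b: intermediate value theorem. *)
Lemma wait_time_exact U : continuous U -> (forall s, 0 <= U s) ->
  (exists p p', [/\ 0 <= p, p < p', p' <= 1 & forall s, p <= s <= p' -> U s = 0]) ->
  forall L, 0 < L -> exists2 b, 0 < b &
    intg 0 1 (fun s => (Num.sqrt (U s + b))^-1) = L.
Proof.
move=> cU U0 HU L L0; pose T b := intg 0 1 (fun s => (Num.sqrt (U s + b))^-1).
have [b0 /andP[b00 _] hb0] := wait_time_large cU U0 HU L.
have sp b s : 0 < b -> 0 < Num.sqrt (U s + b).
  by move=> b1; rewrite sqrtr_gt0 ltr_wpDl.
have cq b : 0 < b -> continuous (fun s => (Num.sqrt (U s + b))^-1).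
  move=> b1; apply: continuous_inv => [|s]; last by rewrite gt_eqF// sp.
  exact: continuous_sqrt_shift.
pose b1 := Num.max b0 (L ^- 2).
have b01 : b0 <= b1 by rewrite le_max lexx.
have b10 : 0 < b1 by exact: lt_le_trans b01.
have hb1 : T b1 <= L.
  rewrite -[leRHS]intg01_cst /T.
  apply: le_intg => [||s _]; [exact/continuous_intble/cq|exact: intble_cst|].
  rewrite -[leRHS]invrK lef_pV2 ?posrE ?invr_gt0 ?sp//.
  rewrite -[L^-1]gtr0_norm ?invr_gt0// -sqrtr_sqr exprVn ler_wsqrtr//.
  by rewrite -[leLHS]add0r lerD// le_max lexx orbT.
(* On [b0, b1] the square roots are at least k, so T is Lipschitz with constant k^-3. *)
pose k := Num.sqrt b0.
have k0 : 0 < k by rewrite sqrtr_gt0.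
have cT : {within `[b0, b1], continuous T}.
  apply: ucont_within => e e0; exists (e * k ^+ 3); first by rewrite mulr_gt0// exprn_gt0.
  move=> x y /andP[x0 _] /andP[y0 _] xy.
  have xp : 0 < x by exact: lt_le_trans x0.
  have yp : 0 < y by exact: lt_le_trans y0.
  rewrite /T -intgB; [|exact/continuous_intble/cq..].
  apply: le_trans (intg_norm _) _.
    by apply: intbleB; exact/continuous_intble/cq.
  rewrite -[leRHS]intg01_cst.
  apply: le_intg => [||s _]; last 1 first.
  - set X := Num.sqrt (U s + x); set Y := Num.sqrt (U s + y).
    have X0 : 0 < X by apply: sp.
    have Y0 : 0 < Y by apply: sp.
    have Xk : k <= X by rewrite ler_wsqrtr// -[leLHS]add0r lerD.
    have Yk : k <= Y by rewrite ler_wsqrtr// -[leLHS]add0r lerD.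
    have X2 : X ^+ 2 = U s + x by rewrite sqr_sqrtr// addr_ge0// ltW.
    have Y2 : Y ^+ 2 = U s + y by rewrite sqr_sqrtr// addr_ge0// ltW.
    have -> : X^-1 - Y^-1 = (y - x) / (X * Y * (X + Y)).
      have -> : y - x = Y ^+ 2 - X ^+ 2 by rewrite X2 Y2; ring.
      by field; rewrite !gt_eqF// addr_gt0.
    have D0 : 0 < X * Y * (X + Y) by rewrite !mulr_gt0// addr_gt0.
    rewrite normrM normfV (gtr0_norm D0) ler_pdivrMr// distrC.
    apply: le_trans xy _; rewrite ler_wpM2l ?(ltW e0)//.
    have -> : k ^+ 3 = k * k * k by ring.
    apply: ler_pM; [by rewrite mulr_ge0// ltW|exact: ltW| |lra].
    by apply: ler_pM => //; exact: ltW.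
  - by apply/intble_norm/intbleB; exact/continuous_intble/cq.
  - exact: intble_cst.
(* The lower end b0 gives T >= L; at b1 >= L^-2 the bound 1 / sqrt b gives T <= L. *)
have [|b] := @IVT _ T b0 b1 L b01 cT.
  by rewrite ge_min le_max hb0 hb1 !orbT.
rewrite in_itv /= => /andP[bb0 _] <-; exists b => //.
exact: lt_le_trans bb0.
Qed.

(** With m the minimum of V and d = e/2, let U be the positive part of V - m - d:
    it vanishes on an interval, so that any prescribed period is reached by some
    q = 1 / sqrt(U + b). With T and S the means of q and 1/q, the cost is at most
    xi^2 T S + S/T + (m + d - b), while the dual value at the level b - m is at
    least 2 xi S + (m - b). The gap is d + S (xi T - 1)^2 / T, whose second term
    vanishes when T = 1/xi and, for xi = 0, is small once T is large. *)
Lemma cell_problem V xi e : continuous V -> (forall s, V (s + 1) = V s) ->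
  0 <= xi -> 0 < e -> exists c q,
  [/\ forall s, 0 < V s + c, continuous q, forall s, q (s + 1) = q s,
      forall s, 0 < q s &
      cell_cost V xi q <= 2 * (level_speed V c * xi) - c + e].
Proof.
move=> cV pV xi0 e0.
have [s0 s001 hs0] := EVT_min (@ler01 R) (continuous_subspaceT cV).
pose m := V s0.
have Vm s : m <= V s.
  by have [z z01 ->] := periodic_reduce s; [apply: hs0; rewrite in_itv|exact: pV].
pose d := e / 2.
have d0 : 0 < d by rewrite divr_gt0.
pose U s := Num.max (V s - m - d) 0.
have cU : continuous U.
  move=> x; apply: (@continuous_max _ _ (fun s => V s - m - d) (fun=> 0)).
    have -> : (fun s => V s - m - d) = (fun s => V s + (- m - d)).
      by apply/funext => s; rewrite addrA.
    by apply: cvgD; [exact: cV|exact: cvg_cst].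
  exact: cst_continuous.
have U0 s : 0 <= U s by rewrite le_max lexx orbT.
have pU s : U (s + 1) = U s by rewrite /U pV.
have HU : exists p p', [/\ 0 <= p, p < p', p' <= 1 & forall s, p <= s <= p' -> U s = 0].
  have /cvgrPdist_le/(_ _ d0)[r /= r0 hr] := cV s0.
  (* Half a period on one side of s0 always fits in [0, 1]. *)
  pose r' := Num.min (r / 2) (1 / 2).
  have r'0 : 0 < r' by rewrite lt_min !divr_gt0.
  have r'1 : r' <= 1 / 2 by rewrite ge_min lexx orbT.
  have r'r : r' < r by rewrite gt_min ltr_pdivrMr// ltr_pMr// ltr1n.
  have Uz s : `|s0 - s| <= r' -> U s = 0.
    move=> h; apply/max_idPr.
    have := hr s (le_lt_trans h r'r); rewrite distrC => /ler_normlP[_].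
    rewrite /m; lra.
  move: s001; rewrite in_itv /= => /andP[s00 s01].
  have [h|h] := leP s0 (1 / 2).
    exists s0, (s0 + r'); split; try lra.
    by move=> s /andP[? ?]; apply: Uz; rewrite ler_norml; apply/andP; split; lra.
  exists (s0 - r'), s0; split; try lra.
  by move=> s /andP[? ?]; apply: Uz; rewrite ler_norml; apply/andP; split; lra.
pose S b := intg 0 1 (fun s => Num.sqrt (U s + b)).
pose T b := intg 0 1 (fun s => (Num.sqrt (U s + b))^-1).
suff [b b0 hb] : exists2 b, 0 < b & S b * (xi * T b - 1) ^+ 2 / T b <= e / 2.
  have sp s : 0 < Num.sqrt (U s + b) by rewrite sqrtr_gt0 ltr_wpDl.
  have cs : continuous (fun s => Num.sqrt (U s + b)).
    exact: continuous_sqrt_shift.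
  have cq : continuous (fun s => (Num.sqrt (U s + b))^-1).
    by apply: continuous_inv => [//|s]; rewrite gt_eqF.
  have T0 : 0 < T b.
    have [||k k0 hk] := periodic_pos cq.
    - by move=> s; rewrite pU.
    - by move=> s; rewrite invr_gt0.
    apply: lt_le_trans k0 _; rewrite -[leLHS]intg01_cst.
    by apply: le_intg => [||s _]; [exact: intble_cst|exact: continuous_intble|exact: hk].
  (* Since V - m >= U, the level b - m makes sqrt(V + c) at least sqrt(U + b). *)
  exists (b - m), (fun s => (Num.sqrt (U s + b))^-1); split => //.
  - by move=> s; have := Vm s; lra.
  - by move=> s; rewrite pU.
  - by move=> s; rewrite invr_gt0.
  have SM : S b <= level_speed V (b - m).
    apply: le_intg => [||s _].
    + exact: continuous_intble.
    + exact/continuous_intble/continuous_sqrt_shift.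
    + rewrite ler_wsqrtr// addrA addrAC lerD2r /U ge_max; apply/andP; split.
        lra.
      by rewrite subr_ge0.
  rewrite /cell_cost -/(T b).
  have -> : intg 0 1 (fun s => ((Num.sqrt (U s + b))^-1)^-1) = S b.
    by apply: eq_intg => s _; rewrite invrK.
  have VT : intg 0 1 (fun s => V s / Num.sqrt (U s + b)) <= S b + (m + d - b) * T b.
    rewrite /S /T -intgZ; last exact: continuous_intble.
    rewrite -intgD; [|exact: continuous_intble|exact/intbleZ/continuous_intble].
    apply: le_intg => [||s _].
    + by apply: continuous_intble => x; apply: cvgM; [exact: cV|exact: cq].
    + by apply: intbleD; [exact: continuous_intble|exact/intbleZ/continuous_intble].
    + rewrite ler_pdivrMr//.
      have Y2 : Num.sqrt (U s + b) ^+ 2 = U s + b by rewrite sqr_sqrtr// addr_ge0// ltW.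
      rewrite mulrDl -expr2 Y2 divfK ?gt_eqF//.
      have : V s - m - d <= U s by rewrite le_max lexx.
      lra.
  have VT' : intg 0 1 (fun s => V s / Num.sqrt (U s + b)) / T b <= S b / T b + (m + d - b).
    by rewrite ler_pdivrMr// mulrDl divfK ?gt_eqF.
  have hb' : xi ^+ 2 * T b * S b + S b / T b - 2 * (S b * xi) <= e / 2.
    apply: le_trans hb; rewrite le_eqVlt; apply/orP; left; apply/eqP; field.
    by rewrite gt_eqF.
  have : S b * xi <= level_speed V (b - m) * xi by rewrite ler_wpM2r.
  rewrite /d in VT'; lra.
move: xi0; rewrite le_eqVlt => /predU1P[<-|xi0].
  have [K K0 hK] := periodic_bounded cU pU.
  pose Sm := Num.sqrt (K + 1).
  have [b /andP[b0 b1] hb] := wait_time_large cU U0 HU (2 * Sm / e + 1).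
  have Sm0 : 0 < Sm by rewrite sqrtr_gt0; lra.
  have T0 : 0 < T b by apply: lt_le_trans hb; rewrite ltr_wpDl// ltW// divr_gt0// mulr_gt0.
  exists b => //; rewrite mul0r sub0r sqrrN expr1n mulr1.
  have hS : S b <= Sm.
    rewrite -[leRHS]intg01_cst /S.
    apply: le_intg => [||s _]; last 1 first.
    - by rewrite ler_wsqrtr// lerD// (le_trans (ler_norm _)).
    - exact/continuous_intble/continuous_sqrt_shift.
    - exact: intble_cst.
  rewrite ler_pdivrMr//; apply: le_trans hS _.
  have : e / 2 * (2 * Sm / e + 1) <= e / 2 * T b by rewrite ler_wpM2l// ltW.
  apply: le_trans; have -> : e / 2 * (2 * Sm / e + 1) = Sm + e / 2.
    by field; rewrite gt_eqF.
  lra.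
have [b b0 hb] := wait_time_exact cU U0 HU (L := xi^-1) ltac:(by rewrite invr_gt0).
exists b => //; rewrite /T hb mulfV ?gt_eqF// subrr expr0n mulr0 mul0r.
by rewrite divr_ge0// ltW.
Qed.

End Cell.

(** * Change of variables for expanding maps *)

Section Expanding.
Context {R : realType}.
Implicit Types (a b c s t x y eps k : R) (f g w phi V W U q : R -> R).
Local Notation mu := (@lebesgue_measure R).

Definition expanding (k : R) (phi : R -> R) : Prop :=
  forall s t, k * `|s - t| <= `|phi s - phi t|.

(** Two points of the preimage are at distance at most (y - x) / k. *)
Lemma expanding_preimage_itv k phi x y : 0 < k -> x <= y ->
  expanding k phi -> measurable_fun setT phi ->
  (mu (phi @^-1` `]x, y]) <= (k^-1 * (y - x))%:E)%E.
Proof.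
move=> k0 xy ephi mphi; pose l := k^-1 * (y - x).
have l0 : 0 <= l by rewrite mulr_ge0// ?invr_ge0 ?subr_ge0// ltW.
set B := phi @^-1` _.
have hB s t : B s -> B t -> s - l <= t.
  rewrite /B /= !in_itv /= => /andP[s1 s2] /andP[t1 t2].
  have := ephi s t; have : `|phi s - phi t| <= y - x by rewrite ler_norml; lra.
  have := ler_norm (s - t).
  move=> h1 h2 h3; rewrite /l lerBlDr -lerBlDl.
  rewrite ler_pdivlMl//.
  by apply: le_trans (le_trans h3 h2); rewrite ler_pM2l.
have mB : measurable B by rewrite -[B]setTI; exact: mphi.
have [[s Bs]|B0] := pselect (exists s, B s); last first.
  have -> : B = set0 by apply/seteqP; split => // s Bs; apply: B0; exists s.
  by rewrite measure0 lee_fin.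
have hinf t : B t -> inf B <= t <= inf B + l.
  move=> Bt; apply/andP; split.
    by apply: ge_inf => //; exists (s - l) => r Br; exact: hB.
  rewrite -lerBlDr; apply: lb_le_inf; first by exists s.
  by move=> r Br; exact: hB.
apply: (@le_trans _ _ (mu `[inf B, inf B + l]%classic)).
  by apply: le_measure; rewrite ?inE//= => t /hinf; rewrite /= in_itv.
rewrite lebesgue_measure_itv /= lte_fin; case: ifP => _; rewrite lee_fin//.
by rewrite /l addrAC subrr add0r.
Qed.

(** Cover A by half-open intervals of almost the same total length. *)
Lemma expanding_preimage k phi (A : set R) : 0 < k -> expanding k phi ->
  measurable_fun setT phi -> measurable A ->
  (mu (phi @^-1` A) <= k^-1%:E * mu A)%E.
Proof.
move=> k0 ephi mphi mA.
have [Afin|] := ltP (mu A) +oo%E; last first.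
  by rewrite leye_eq => /eqP ->; rewrite gt0_muley ?leey// lte_fin invr_gt0.
have mAfin : mu A \is a fin_num by rewrite ge0_fin_numE.
rewrite -(fineK mAfin) -EFinM; apply/lee_addgt0Pr => e e0; rewrite -EFinD.
have ke0 : 0 < k * e by rewrite mulr_gt0.
have /ereal_inf_lt[z [/= M' covM sMz zDe]] : (mu A < mu A + (k * e)%:E)%E.
  by rewrite lteDl// lte_fin.
have oM n : ocitv (M' n) by case: covM => h _; exact: h.
have mM' n : measurable (M' n : set R).
  case/ocitvP: (oM n) => [->|[[a b] _ ->]]; first exact: measurable0.
  exact: measurable_itv.
have mpM n : measurable (phi @^-1` (M' n)).
  by rewrite -[_ @^-1` _]setTI; exact: mphi.
apply: (@le_trans _ _ (\sum_(n <oo) mu (phi @^-1` (M' n)))%E).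
  apply: measure_sigma_subadditive => //.
    by rewrite -[_ @^-1` _]setTI; exact: mphi.
  by case: covM => _ h t /= /h[n _ hn]; exists n.
apply: (@le_trans _ _ (\sum_(n <oo) (k^-1%:E * wlength idfun (M' n)))%E).
  apply: lee_nneseries => [n _ _|n _]; first exact: measure_ge0.
  have /ocitvP[->|[[a b] /= ab ->]] := oM n.
    by rewrite preimage_set0 measure0 wlength0 mule0.
  rewrite wlength_itv_bnd ?(ltW ab)//= -EFinM.
  exact: expanding_preimage_itv (ltW ab) ephi mphi.
rewrite nneseriesZl; last by move=> n _; exact: wlength_ge0.
rewrite sMz -[e](mulKf (lt0r_neq0 k0)) -mulrDr EFinM.
apply: lee_wpmul2l; first by rewrite lee_fin invr_ge0 ltW.
by rewrite EFinD fineK// ltW.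
Qed.

(** The image of Lebesgue measure under phi is at most k^-1 times Lebesgue measure,
    which transfers to the integrals of nonnegative measurable functions. *)
Lemma expanding_integral k phi W s t x y : 0 < k -> expanding k phi ->
  measurable_fun setT phi -> measurable_fun setT W -> (forall r, 0 <= W r) ->
  (forall r, s <= r <= t -> x <= phi r <= y) ->
  (\int[mu]_(r in `[s, t]) (W (phi r))%:E <=
   k^-1%:E * \int[mu]_(r in `[x, y]) (W r)%:E)%E.
Proof.
move=> k0 ephi mphi mW W0 hst.
have mWphi : measurable_fun setT (fun r => (W (phi r))%:E).
  by apply/measurable_EFinP; apply: (@measurableT_comp _ _ _ _ _ _ W).
have mpre : measurable (phi @^-1` `[x, y]).
  by rewrite -[_ @^-1` _]setTI; exact: mphi.
apply: (@le_trans _ _ (\int[mu]_(r in phi @^-1` `[x, y]) ((EFin \o W) \o phi) r)%E).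
  apply: ge0_subset_integral => //.
  - exact: measurable_funS mWphi.
  - by move=> r _; rewrite lee_fin.
have mWE : measurable_fun setT (EFin \o W) by exact/measurable_EFinP.
pose lam : {measure set (measurableTypeR R) -> \bar R} := lebesgue_measure.
have mWxy : measurable_fun `[x, y] (EFin \o W) by exact: measurable_funS mWE.
have WE0 : {in `[x, y]%classic, forall r, (0%R <= (EFin \o W) r)%E}.
  by move=> r _; rewrite lee_fin.
have e1 := @ge0_integral_pushforward _ _ (measurableTypeR R) (measurableTypeR R)
  R phi mphi lam `[x, y]%classic (EFin \o W) (measurable_itv _) mWxy WE0.
have ki0 : 0 <= k^-1 by rewrite invr_ge0 ltW.
have e2 := @ge0_integral_mscale _ (measurableTypeR R) R lam `[x, y]%classic
  (measurable_itv _) (NngNum ki0) (EFin \o W) mWxy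
  (fun r _ => W0 r : (0%R <= (W r)%:E)%E).
rewrite -[X in (X <= _)%E]e1 -[X in (_ <= X)%E]e2.
apply: ge0_le_measure_integral => //.
by move=> A mA; apply: expanding_preimage.
Qed.

End Expanding.

(** * Transitions between two values *)

(** The reference function h records how far the path may stray in the uniform
    norm; B bounds its energy with W included. The bound on g gives square
    integrability. *)
Definition transition (R : realType) (V W : R -> R) (eps s t a b : R)
    (h : R -> R) (rho B : R) : Prop :=
  exists f g : R -> R,
  [/\ abs_cont s t f g, exists K, forall x, s <= x <= t -> `|g x| <= K,
      f s = a /\ f t = b /\ (forall x, s <= x <= t -> `|f x - h x| <= rho),
      intble s t (fun x => W (f x / eps)) &
      intg s t (fun x => g x ^+ 2 + V (f x / eps) + W (f x / eps)) <= B].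

Section Segment.
Context {R : realType}.
Implicit Types (a b c d e r s t x y eps k : R) (f g w phi V W U q Q : R -> R).
Local Notation mu := (@lebesgue_measure R).

Definition mean_zero (W : R -> R) : Prop :=
  ((r^-1)%:E * \int[mu]_(s in `[(- r)%R, r]) (W s)%:E)%E @[r --> +oo%R] --> 0%E.

Lemma mean_zero_small W r d : mean_zero W -> 0 < r -> 0 < d ->
  \forall eps \near (0 : R)^'+,
    (\int[mu]_(s in `[(- (r / eps))%R, (r / eps)%R]) (W s)%:E <= (d / eps)%:E)%E.
Proof.
move=> hW r0 d0.
have dr0 : 0 < d / r by rewrite divr_gt0.
have : \forall rho \near +oo%R,
    (\int[mu]_(s in `[(- rho)%R, rho]) (W s)%:E <= (d / r * rho)%:E)%E.
  move/fine_cvgP : hW => [h1 /cvgrPdist_le/(_ _ dr0) h2].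
  have h3 : \forall rho \near +oo%R, (0 : R) < rho by exact: nbhs_pinfty_gt.
  near=> rho.
  have rho0 : 0 < rho by near: rho.
  have f1 : ((rho^-1)%:E * \int[mu]_(s in `[(- rho)%R, rho]) (W s)%:E)%E \is a fin_num.
    by near: rho.
  have f2 : `|0 - fine ((rho^-1)%:E * \int[mu]_(s in `[(- rho)%R, rho]) (W s)%:E)%E| <= d / r.
    by near: rho.
  rewrite mulrC EFinM -lee_pdivrMl// -(fineK f1) lee_fin.
  by apply: le_trans f2; rewrite sub0r normrN ler_norm.
move=> [M [_ hM]].
have M0 : 0 < `|M| + 1 by rewrite ltr_wpDl.
near=> eps.
have e0 : 0 < eps by near: eps; exact: nbhs_right_gt.
have -> : d / eps = d / r * (r / eps) by field; rewrite !gt_eqF.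
apply: hM; apply: (@lt_trans _ _ (`|M| + 1)).
  by rewrite (le_lt_trans (ler_norm _))// ltrDl.
rewrite ltr_pdivlMr// mulrC -ltr_pdivlMr//.
by near: eps; apply: nbhs_right_lt; rewrite divr_gt0.
Unshelve. all: by end_near. Qed.

(** The inverse w of a primitive of q solves the autonomous equation w' = 1 / q(w). *)
Lemma inverse_profile q k : continuous q -> 0 < k -> (forall s, k <= q s) ->
  exists Q w, [/\ forall s, is_derive s 1 Q (q s), forall y, Q (w y) = y,
    forall x, w (Q x) = x &
    forall y, is_derive y 1 w (q (w y))^-1].
Proof.
move=> cq k0 kq; have [Q [Q0 dQ]] := primitive_exists cq.
have cQ : continuous Q.
  by move=> x; apply/differentiable_continuous/derivable1_diffP.
have q0 s : 0 < q s by exact: lt_le_trans (kq s).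
have grow x y : x <= y -> k * (y - x) <= Q y - Q x.
  move=> xy; have [z [-> _]] := mean_value_between x y dQ.
  by rewrite ler_wpM2r// subr_ge0.
have inj x y : Q x = Q y -> x = y.
  move=> e; have [z [e2 _]] := mean_value_between x y dQ.
  move: e2; rewrite e subrr => /esym/eqP; rewrite mulf_eq0 (gt_eqF (q0 z)) /=.
  by rewrite subr_eq0 => /eqP.
have surj y : exists x, Q x = y.
  pose r := `|y| / k; have r0 : 0 <= r by rewrite divr_ge0// ltW.
  have kr : k * r = `|y| by rewrite /r mulrC divfK// gt_eqF.
  have h1 := grow 0 r r0; have h2 : k * (0 - - r) <= Q 0 - Q (- r).
    by apply: grow; rewrite oppr_le0.
  have yn := ler_norm y; have yn2 : - y <= `|y| by rewrite -normrN ler_norm.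
  have rr : - r <= r by lra.
  have [|x _ <-] := @IVT _ Q (- r) r y rr (continuous_subspaceT cQ).
    rewrite ge_min le_max; apply/andP; split; apply/orP; [left|right]; lra.
  by exists x.
have /choice[w hw] := surj.
have wQ x : w (Q x) = x by apply: inj; rewrite hw.
exists Q, w; split => // y.
rewrite -[y in is_derive y]hw; apply: is_derive_inverse.
- by near=> x; rewrite wQ.
- by near=> x; exact: cQ.
- by rewrite gt_eqF.
Unshelve. all: by end_near. Qed.

Lemma scaled_cvg Phi phi a b : continuous phi ->
  (forall s, phi (s + 1) = phi s) -> (forall s, is_derive s 1 Phi (phi s)) ->
  eps * (Phi (a / eps) - Phi (b / eps)) @[eps --> (0 : R)^'+] -->
    intg 0 1 phi * (a - b).
Proof.
move=> cphi pphi dPhi; have [K K0 hK] := primitive_periodic cphi pphi dPhi.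
apply/cvgrPdist_le => e e0; near=> eps.
have ep0 : 0 < eps by near: eps; exact: nbhs_right_gt.
rewrite distrC; apply: le_trans (hK _ _ _ ep0) _.
rewrite -ler_pdivlMr//; near: eps; apply: nbhs_right_le.
by rewrite divr_gt0.
Unshelve. all: by end_near. Qed.

(** The path solves f' = k / q(f/eps), with k chosen so that f t = b. Then
    f'^2 + V(f/eps) is the derivative of k eps P(f/eps) + k^-1 eps U(f/eps), where
    P and U are primitives of 1/q and V q, so that its integral depends only on
    the end points. As eps tends to 0, k tends to (b - a) M(q) / (t - s), which is
    not 0; hence f/eps is expanding and W contributes little. *)
Lemma monotone_segment V W q s t a b e :
  continuous V -> (forall s, V (s + 1) = V s) ->
  measurable_fun [set: R] W -> (forall s, 0 <= W s) -> mean_zero W ->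
  continuous q -> (forall s, q (s + 1) = q s) -> (forall s, 0 < q s) ->
  s < t -> a != b -> 0 < e ->
  \forall eps \near (0 : R)^'+, transition V W eps s t a b (fun=> a) `|b - a|
    ((t - s) * cell_cost V ((b - a) / (t - s)) q + e).
Proof.
move=> cV pV mW W0 hW cq pq q0 st ab e0.
have [kq kq0 hkq] := periodic_pos cq pq q0.
have [Kq Kq0 hKq] := periodic_bounded cq pq.
have [Q [w [dQ Qw wQ dw]]] := inverse_profile cq kq0 hkq.
have qn0 x : q x != 0 by rewrite gt_eqF.
have cqi : continuous (fun x => (q x)^-1) by exact: continuous_inv.
have [P [_ dP]] := primitive_exists cqi.
have cVq : continuous (fun x => V x * q x).
  by move=> x; apply: cvgM; [exact: cV|exact: cq].
have [U [_ dU]] := primitive_exists cVq.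
have h0 : 0 < t - s by rewrite subr_gt0.
pose k eps := eps * (Q (b / eps) - Q (a / eps)) / (t - s).
pose k_ := intg 0 1 q * (b - a) / (t - s).
have kk : k eps @[eps --> (0 : R)^'+] --> k_.
  by apply: cvgM; [exact: scaled_cvg|exact: cvg_cst].
have M0 : 0 < intg 0 1 q.
  apply: lt_le_trans kq0 _; rewrite -[leLHS]intg01_cst.
  by apply: le_intg => [||x _]; [exact: intble_cst|exact: continuous_intble|exact: hkq].
have k_0 : k_ != 0.
  rewrite /k_ mulf_neq0 ?invr_eq0 ?(gt_eqF h0)// mulf_neq0 ?(gt_eqF M0)//.
  by rewrite subr_eq0 eq_sym.
have nk_0 : 0 < `|k_| by rewrite normr_gt0.
pose En eps := k eps * (eps * (P (b / eps) - P (a / eps))) +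
  (k eps)^-1 * (eps * (U (b / eps) - U (a / eps))).
have cEn : En eps @[eps --> (0 : R)^'+] --> (t - s) * cell_cost V ((b - a) / (t - s)) q.
  have -> : (t - s) * cell_cost V ((b - a) / (t - s)) q =
      k_ * (intg 0 1 (fun x => (q x)^-1) * (b - a)) +
      k_^-1 * (intg 0 1 (fun x => V x * q x) * (b - a)).
    rewrite /cell_cost /k_; field.
    by rewrite (gt_eqF h0) (gt_eqF M0) /= andbT subr_eq0 eq_sym.
  apply: cvgD; apply: cvgM => //.
  - by apply: scaled_cvg => // x; rewrite pq.
  - exact: cvgV.
  - by apply: scaled_cvg => // x; rewrite pV pq.
(* The path stays in [-r, r]. *)
pose r := `|a| + `|b - a| + 1.
have r0 : 0 < r by rewrite ltr_wpDl// addr_ge0.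
(* Chosen so that the factor 2 Kq / |k_| of the change of variables leaves e / 2. *)
pose d := e * `|k_| / (4 * Kq).
have d0 : 0 < d by rewrite divr_gt0 ?mulr_gt0.
have nW := mean_zero_small hW r0 d0.
have nE : \forall eps \near (0 : R)^'+,
    En eps <= (t - s) * cell_cost V ((b - a) / (t - s)) q + e / 2.
  by apply: (cvgr_le _ cEn); rewrite ltrDl divr_gt0.
have nk : \forall eps \near (0 : R)^'+, `|k_| / 2 <= `|k eps|.
  by apply: (cvgr_ge _ (cvg_norm kk)); rewrite ltr_pdivrMr// ltr_pMr// ltr1n.
near=> eps.
have ep0 : 0 < eps by near: eps; exact: nbhs_right_gt.
have hk : `|k_| / 2 <= `|k eps| by near: eps.
have hE : En eps <= (t - s) * cell_cost V ((b - a) / (t - s)) q + e / 2 by near: eps.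
have hWe : (\int[mu]_(s in `[(- (r / eps))%R, (r / eps)%R]) (W s)%:E <= (d / eps)%:E)%E.
  by near: eps.
have nke0 : 0 < `|k eps| by apply: lt_le_trans hk; rewrite divr_gt0.
have ke0 : k eps != 0 by rewrite -normr_gt0.
have epn : eps != 0 by rewrite gt_eqF.
pose f x := eps * w (Q (a / eps) + k eps / eps * (x - s)).
pose g x := k eps / q (f x / eps).
have fE x : f x / eps = w (Q (a / eps) + k eps / eps * (x - s)).
  by rewrite /f mulrAC mulfV// mul1r.
have df x : is_derive x 1 f (g x).
  have dl : is_derive x 1 (fun x => Q (a / eps) + k eps / eps * (x - s) : R) (k eps / eps).
    by apply: is_derive_eq; rewrite /GRing.scale /=; ring.
  have := is_deriveZ eps (@is_derive1_comp R w
    (fun x => Q (a / eps) + k eps / eps * (x - s)) x _ _ (dw _) dl).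
  rewrite -fE; have -> : eps *: ((q (f x / eps))^-1 * (k eps / eps)) = g x.
    by rewrite /GRing.scale /= /g; field; rewrite epn qn0.
  by [].
have cf : continuous f.
  by move=> x; apply/differentiable_continuous/derivable1_diffP.
have cfe : continuous (fun x => f x / eps).
  by move=> x; apply: cvgM; [exact: cf|exact: cvg_cst].
have cqf : continuous (fun x => q (f x / eps)).
  by move=> x; apply: (@continuous_comp _ _ _ (fun x => f x / eps) q); [exact: cfe|exact: cq].
have cVf : continuous (fun x => V (f x / eps)).
  by move=> x; apply: (@continuous_comp _ _ _ (fun x => f x / eps) V); [exact: cfe|exact: cV].
have cg : continuous g.
  by move=> x; apply: cvgM; [exact: cvg_cst|apply: cvgV => //; exact: cqf].
have fs : f s = a.
  by rewrite /f subrr mulr0 addr0 wQ mulrC divfK.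
have ft : f t = b.
  rewrite /f; have -> : Q (a / eps) + k eps / eps * (t - s) = Q (b / eps).
    by rewrite /k; field; rewrite epn gt_eqF.
  by rewrite wQ mulrC divfK.
have fclose x : s <= x <= t -> `|f x - a| <= `|b - a|.
  move=> /andP[sx xt].
  have [z [e1 _]] := mean_value_between s x df.
  have [z' [e2 _]] := mean_value_between x t df.
  rewrite fs in e1; rewrite ft in e2.
  have pz y : 0 < (q (f y / eps))^-1 by rewrite invr_gt0.
  have [kp|kn] : 0 < k eps \/ k eps < 0.
    by move: ke0; rewrite neq_lt => /orP[]; [right|left].
  - have gp y : 0 <= g y by rewrite /g mulr_ge0// ltW.
    have : 0 <= f x - a by rewrite e1 mulr_ge0// subr_ge0.
    have : 0 <= b - f x by rewrite e2 mulr_ge0// subr_ge0.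
    move=> u1 u2; clear -u1 u2; rewrite !ger0_norm//; lra.
  - have gn y : g y <= 0 by rewrite /g mulr_le0_ge0// ltW.
    have : f x - a <= 0 by rewrite e1 mulr_le0_ge0// subr_ge0.
    have : b - f x <= 0 by rewrite e2 mulr_le0_ge0// subr_ge0.
    move=> u1 u2; clear -u1 u2; rewrite !ler0_norm//; lra.
have hac := ac_smooth s t df cg.
have cgV : continuous (fun x => g x ^+ 2 + V (f x / eps)).
  by move=> x; apply: cvgD; [apply: cvgM; exact: cg|exact: cVf].
have en1 : intg s t (fun x => g x ^+ 2 + V (f x / eps)) = En eps.
  pose Z x := k eps * (eps * P (f x / eps)) + (k eps)^-1 * (eps * U (f x / eps)).
  have dZ x : is_derive x 1 Z (g x ^+ 2 + V (f x / eps)).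
    have d1 := @is_derive1_comp R (fun y => eps * P (y / eps)) f x _ _
      (scaled_primitive ep0 dP (f x)) (df x).
    have d2 := @is_derive1_comp R (fun y => eps * U (y / eps)) f x _ _
      (scaled_primitive ep0 dU (f x)) (df x).
    have := is_deriveD (is_deriveZ (k eps) d1) (is_deriveZ (k eps)^-1 d2).
    have -> : k eps *: ((q (f x / eps))^-1 * g x) +
        (k eps)^-1 *: (V (f x / eps) * q (f x / eps) * g x) = g x ^+ 2 + V (f x / eps).
      by rewrite /GRing.scale /= /g; field; rewrite ke0 qn0.
    by [].
  rewrite (ac_smooth s t dZ cgV).2 ?lexx ?(ltW st)// /Z fs ft /En; ring.
have exf : expanding (`|k eps| / (Kq * eps)) (fun x => f x / eps).
  move=> x y; have -> : f x / eps - f y / eps = (f x - f y) / eps by ring.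
  have [z [-> _]] := mean_value_between y x df.
  have gz : `|k eps| / Kq <= `|g z|.
    have -> : `|g z| = `|k eps| / `|q (f z / eps)| by rewrite -normf_div.
    by rewrite ler_pM2l// lef_pV2 ?posrE ?normr_gt0.
  have -> : `|g z * (x - y) / eps| = `|g z| * `|x - y| / eps.
    by rewrite (normrM (g z * _)) (normrM (g z)) normfV (gtr0_norm ep0).
  have -> : `|k eps| / (Kq * eps) * `|x - y| = `|k eps| / Kq * `|x - y| / eps.
    by field; rewrite epn gt_eqF.
  by rewrite ler_wpM2r ?invr_ge0 ?(ltW ep0)// ler_wpM2r.
have mfe : measurable_fun setT (fun x => f x / eps).
  exact: continuous_measurable_fun.
have c0 : 0 < `|k eps| / (Kq * eps) by rewrite divr_gt0// mulr_gt0.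
have range x : s <= x <= t -> - (r / eps) <= f x / eps <= r / eps.
  move=> /fclose; rewrite -ler_norml normrM normfV (gtr0_norm ep0) ler_pM2r ?invr_gt0//.
  move=> h; have -> : f x = a + (f x - a) by ring.
  by apply: le_trans (ler_normD _ _) _; rewrite /r; lra.
have iW : (\int[mu]_(x in `[s, t]) (W (f x / eps))%:E <= (e / 2)%:E)%E.
  apply: le_trans (expanding_integral c0 exf mfe mW W0 range) _.
  apply: (@le_trans _ _ ((`|k eps| / (Kq * eps))^-1%:E * (d / eps)%:E)%E).
    by apply: lee_wpmul2l => //; rewrite lee_fin invr_ge0 ltW.
  rewrite -EFinM lee_fin /d invf_div.
  have -> : Kq * eps / `|k eps| * (e * `|k_| / (4 * Kq) / eps) =
      e / 2 * (`|k_| / 2 / `|k eps|).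
    by field; rewrite epn !gt_eqF.
  by rewrite ler_piMr ?divr_ge0 ?(ltW e0)// ler_pdivrMr// mul1r.
have iWf : intble s t (fun x => W (f x / eps)).
  apply/integrableP; split.
    apply/measurable_EFinP; apply: (@measurableT_comp _ _ _ _ _ _ W) => //.
    exact: continuous_meas.
  apply: le_lt_trans (ltry (e / 2)).
  apply: le_trans iW; rewrite le_eqVlt; apply/orP; left; apply/eqP.
  by apply: eq_integral => x _ /=; rewrite ger0_norm.
exists f, g; split => //.
  have [K _ hK] := continuous_bounded_segment s t cg; by exists K.
rewrite intgD//; last exact: continuous_intble.
have : intg s t (fun x => W (f x / eps)) <= e / 2 by rewrite -lee_fin -intgE.
rewrite en1; lra.
Unshelve. all: by end_near. Qed.

End Segment.

(** * Gluing transitions *)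

Section Recovery.
Context {R : realType}.
Implicit Types (a b c d e r s t x y eps k rho : R).
Implicit Types (f g h w phi V W U q Q : R -> R) (u v : H1 R).
Local Notation mu := (@lebesgue_measure R).

Lemma L2_bounded_ac a b f g K : abs_cont a b f g ->
  (forall x, a <= x <= b -> `|g x| <= K) -> L2 a b g.
Proof. by move=> [ig _] gK; exact: L2_bounded (intble_meas ig) gK. Qed.

Lemma transition_density V W eps s t f g K : continuous V ->
  (forall s, V (s + 1) = V s) -> abs_cont s t f g ->
  (forall x, s <= x <= t -> `|g x| <= K) ->
  intble s t (fun x => W (f x / eps)) ->
  intble s t (fun x => g x ^+ 2 + V (f x / eps) + W (f x / eps)).
Proof.
move=> cV pV hf gK iW; apply: intbleD => //.
exact: energy_density_intble (L2_bounded_ac hf gK).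
Qed.

Lemma transition_weaken V W eps s t a b h h' rho rho' B B' :
  (forall x, s <= x <= t -> `|h x - h' x| + rho <= rho') -> B <= B' ->
  transition V W eps s t a b h rho B -> transition V W eps s t a b h' rho' B'.
Proof.
move=> hr BB [f [g [h1 h2 [fs [ft fh]] h4 h5]]]; exists f, g; split => //.
  split => //; split => // x sxt.
  have -> : f x - h' x = (h x - h' x) + (f x - h x) by ring.
  apply: le_trans (ler_normD _ _) _; apply: le_trans (hr _ sxt).
  by rewrite lerD2l fh.
exact: le_trans BB.
Qed.

Lemma transition_concat V W eps s r t a b c h rho B B' : continuous V ->
  (forall s, V (s + 1) = V s) -> s <= r <= t ->
  transition V W eps s r a b h rho B -> transition V W eps r t b c h rho B' ->
  transition V W eps s t a c h rho (B + B').
Proof.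
move=> cV pV srt [f [g [hf [K gK] [fs [fr fh]] iW en]]]
  [F [G [hF [K' GK] [Fr [Ft Fh]] iW' en']]].
have [sr rt] := andP srt.
exists (concat_at r f F), (concat_at r g G); split.
- by apply: concat_at_ac => //; rewrite fr Fr.
- exists (Num.max K K') => x /andP[sx xt]; rewrite le_max.
  have [xr|rx] := leP x r; first by rewrite concat_at_left// gK// sx.
  by rewrite concat_at_right// GK ?orbT// xt (ltW rx).
- split; first by rewrite concat_at_left.
  split.
    move: rt; rewrite le_eqVlt => /predU1P[e|rt]; last by rewrite concat_at_right.
    by rewrite -e concat_at_left// fr -Fr e.
  move=> x /andP[sx xt].
  have [xr|rx] := leP x r; first by rewrite concat_at_left// fh// sx.
  by rewrite concat_at_right// Fh ?orbT// xt (ltW rx).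
- have -> : (fun x => W (concat_at r f F x / eps)) =
    concat_at r (fun x => W (f x / eps)) (fun x => W (F x / eps)).
    by apply/funext => x; rewrite /concat_at; case: ifP.
  exact: concat_at_intble.
- have -> : (fun x => concat_at r g G x ^+ 2 + V (concat_at r f F x / eps) +
      W (concat_at r f F x / eps)) =
    concat_at r (fun x => g x ^+ 2 + V (f x / eps) + W (f x / eps))
           (fun x => G x ^+ 2 + V (F x / eps) + W (F x / eps)).
    by apply/funext => x; rewrite /concat_at; case: ifP.
  rewrite concat_at_intg//; [exact: lerD|exact: transition_density gK iW|].
  exact: transition_density GK iW'.
Qed.

Lemma transition_point V W eps s a h rho : 0 <= rho -> h s = a ->
  transition V W eps s s a a h rho 0.
Proof.
move=> r0 hs; exists (fun=> a), (fun=> 0); split.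
- split; first exact: intble_cst.
  by move=> x y _ xy _; rewrite intg_cst// mul0r subrr.
- by exists 0 => x _; rewrite normr0.
- split => //; split => // x; rewrite -eq_le => /eqP <-.
  by rewrite hs subrr normr0.
- exact: intble_cst.
- by rewrite intg_pt.
Qed.

Lemma cell_cost_sqr V x y q : x ^+ 2 = y ^+ 2 -> cell_cost V x q = cell_cost V y q.
Proof. by rewrite /cell_cost => ->. Qed.

Section Data.
Variables (V W : R -> R).
Hypotheses (cV : continuous V) (pV : forall s, V (s + 1) = V s)
  (mW : measurable_fun [set: R] W) (W0 : forall s, 0 <= W s) (hW : mean_zero W).

(** If a != b, use the monotone path with an almost optimal profile. If a = b, go up
    to a + z L during the first half, of length L, and come back during the second
    one: with q almost optimal for the slope 0, the cost for the slope z exceeds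
    the cost for the slope 0 by z^2 M(q) M(1/q) only. A path that waits at a
    minimizer of V is excluded as W may be large there. *)
Lemma transition_exists s t a b e h rho : s < t -> 0 < e -> 0 < rho ->
  (forall x, s <= x <= t -> `|h x - a| + `|b - a| <= rho / 2) ->
  exists c, (forall s, 0 < V s + c) /\
  \forall eps \near (0 : R)^'+, transition V W eps s t a b h rho
    (2 * (level_speed V c * `|b - a|) - c * (t - s) + e).
Proof.
move=> st e0 rho0 hh; have h0 : 0 < t - s by rewrite subr_gt0.
have e10 : 0 < e / (2 * (t - s)) by rewrite divr_gt0// mulr_gt0.
have [ab|ab] := eqVneq a b; last first.
  have xi0 : 0 <= `|b - a| / (t - s) by rewrite divr_ge0// ltW.
  have [c [q [Vc cq pq q0 hq]]] := cell_problem cV pV xi0 e10.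
  exists c; split => //.
  have := monotone_segment cV pV mW W0 hW cq pq q0 st ab (divr_gt0 e0 (ltr0Sn _ 1)).
  apply: filterS => eps; apply: transition_weaken => [x sxt|].
    have := hh _ sxt; have := normr_ge0 (h x - a); rewrite (distrC a); lra.
  rewrite (@cell_cost_sqr _ _ (`|b - a| / (t - s))); last first.
    by rewrite !exprMn real_normK ?num_real.
  have : (t - s) * cell_cost V (`|b - a| / (t - s)) q <=
    (t - s) * (2 * (level_speed V c * (`|b - a| / (t - s))) - c + e / (2 * (t - s))).
    by rewrite ler_pM2l.
  have -> : (t - s) * (2 * (level_speed V c * (`|b - a| / (t - s))) - c + e / (2 * (t - s)))
    = 2 * (level_speed V c * `|b - a|) - c * (t - s) + e / 2.
    by field; rewrite gt_eqF.
  lra.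
have [c [q [Vc cq pq q0 hq]]] := cell_problem cV pV (lexx 0) e10.
exists c; split => //.
pose A := intg 0 1 q * intg 0 1 (fun s => (q s)^-1).
have A0 : 0 <= A.
  by rewrite mulr_ge0// intg_ge0// => x _; rewrite ?invr_ge0 ltW.
pose L := (t - s) / 2; have L0 : 0 < L by rewrite divr_gt0.
(* The bound 1 gives z^2 <= z; the others control the cost and the height. *)
pose z := Num.min 1 (Num.min (e / (8 * (A * L + 1))) (rho / 4 / L)).
have AL : 0 < A * L + 1 by rewrite ltr_wpDl// mulr_ge0// ltW.
have z0 : 0 < z.
  by rewrite !lt_min ltr01 !divr_gt0//= mulr_gt0.
have z1 : z <= 1 by rewrite ge_min lexx.
have ze : z * (A * L + 1) <= e / 8.
  rewrite -ler_pdivlMr// -mulrA -invfM; apply: le_trans (_ : e / (8 * (A * L + 1)) <= _) => //.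
  by rewrite !ge_min lexx !orbT.
have zr : z * L <= rho / 4 by rewrite -ler_pdivlMr// !ge_min lexx !orbT.
have zL0 : 0 < z * L by rewrite mulr_gt0.
pose m := (s + t) / 2.
have ms : m - s = L by rewrite /m /L; field.
have tm : t - m = L by rewrite /m /L; field.
have sm : s < m by rewrite -subr_gt0 ms.
have mt : m < t by rewrite -subr_gt0 tm.
have am : a != a + z * L by rewrite -subr_eq0 opprD addrA subrr sub0r oppr_eq0 gt_eqF.
have ma : a + z * L != a by rewrite eq_sym.
have e8 : 0 < e / 8 by rewrite divr_gt0.
have cost x : x ^+ 2 = z ^+ 2 -> L * cell_cost V x q + e / 8 <= - c * L + e / 2.
  move=> xz; rewrite (cell_cost_sqr _ _ xz).
  have hc : intg 0 1 (fun s => V s * q s) / intg 0 1 q <= - c + e / (2 * (t - s)).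
    by move: hq; rewrite /cell_cost expr0n !mul0r add0r mulr0 mulr0 add0r.
  have : L * cell_cost V z q <= L * (z * A + (- c + e / (2 * (t - s)))).
    rewrite ler_pM2l// /cell_cost lerD// -mulrA -/A ler_wpM2r//.
    by rewrite expr2 ler_piMl// ltW.
  have -> : L * (z * A + (- c + e / (2 * (t - s)))) = z * (A * L) - c * L + e / 4.
    by rewrite /L; field; rewrite gt_eqF.
  lra.
have n1 := monotone_segment cV pV mW W0 hW cq pq q0 sm am e8.
have n2 := monotone_segment cV pV mW W0 hW cq pq q0 mt ma e8.
rewrite -ab subrr normr0 !mulr0 sub0r.
have up : a + z * L - a = z * L by ring.
have down : a - (a + z * L) = - (z * L) by ring.
have near_a x : s <= x <= t -> `|a - h x| <= rho / 2.
  by move=> /hh; rewrite -ab subrr normr0 addr0 distrC.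
apply: filterS2 n1 n2 => eps n1 n2.
apply: (@transition_weaken V W eps s t a a h h rho rho
  (- c * L + e / 2 + (- c * L + e / 2))) => [x _||].
- by rewrite subrr normr0 add0r.
- by rewrite /L; lra.
apply: (@transition_concat V W eps s m t a (a + z * L) a) => //.
- by rewrite !ltW.
- apply: transition_weaken n1 => [x /andP[sx xm]|].
    have sxt : s <= x <= t by rewrite sx (le_trans xm (ltW mt)).
    have := near_a _ sxt; rewrite up (gtr0_norm zL0); lra.
  by rewrite ms up mulfK ?gt_eqF//; exact: cost.
- apply: transition_weaken n2 => [x /andP[mx xt]|].
    have sxt : s <= x <= t by rewrite xt (le_trans (ltW sm) mx).
    have -> : a + z * L - h x = (a - h x) + z * L by ring.
    have := ler_normD (a - h x) (z * L); have := near_a _ sxt.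
    rewrite down normrN (gtr0_norm zL0); lra.
  by rewrite tm down mulNr mulfK ?gt_eqF//; apply: cost; rewrite sqrrN.
Qed.

End Data.
End Recovery.

(** * Passing from approximations to weakly convergent families *)

Section Limsup.
Context {R : realType}.
Implicit Types (a b c d e r s t x y eps k rho : R).
Implicit Types (f g h w phi : R -> R) (u v : H1 R).
Local Notation mu := (@lebesgue_measure R).

(** Only the derivative needs care: approximate v' by a test function phi in mean
    square, with a weighted Young inequality for the remainder, and move the
    derivative to phi in the main term. *)
Lemma weakly_cvg_of_uniform (x_ : R -> H1 R) u f C : represents f u ->
  (\forall e \near (0 : R)^'+, represents (x_ e) (x_ e)) ->
  (forall d, 0 < d -> \forall e \near (0 : R)^'+,
     forall t, 0 <= t <= 1 -> `|x_ e t - f t| <= d) ->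
  (\forall e \near (0 : R)^'+, intg 0 1 (fun t => H1_deriv (x_ e) t ^+ 2) <= C) ->
  weakly_cvg x_ u.
Proof.
move=> hf hx unif hC v.
have Lf := represents_L2 hf; have Lg := H1_deriv_in_L2 u.
have Lv := H1_fun_in_L2 v; have Lv' := H1_deriv_in_L2 v.
pose D := 2 * C + 2 * intg 0 1 (fun t => H1_deriv u t ^+ 2).
apply/cvgrPdist_le => e e0.
(* Young weight: D bounds the squared norm of the difference of derivatives. *)
pose l := e / (2 * (`|D| + 1)).
have D0 : 0 < `|D| + 1 by rewrite ltr_wpDl.
have l0 : 0 < l by rewrite divr_gt0// mulr_gt0.
have [phi tphi hphi] := test_dense Lv' (divr_gt0 (mulr_gt0 l0 e0) (ltr0Sn _ 1)).
have Lp : L2 0 1 phi by apply: continuous_L2; exact: test_function_continuous.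
have Ldp : L2 0 1 (derive1 phi) by apply: continuous_L2; case: tphi.
pose M := intg 0 1 (fun t => `|v t|) + intg 0 1 (fun t => `|derive1 phi t|) + 1.
have M0 : 0 < M by rewrite ltr_wpDl// addr_ge0// intg_ge0.
have eM : 0 < e / (2 * M) by rewrite divr_gt0// mulr_gt0.
have n1 := unif _ eM.
near=> ep.
have h1 : forall t, 0 <= t <= 1 -> `|x_ ep t - f t| <= e / (2 * M) by near: ep.
have h2 : intg 0 1 (fun t => H1_deriv (x_ ep) t ^+ 2) <= C by near: ep.
have hX : represents (x_ ep) (x_ ep) by near: ep.
set X := x_ ep in h1 h2 hX *.
have LX := H1_fun_in_L2 X; have LG := H1_deriv_in_L2 X.
pose w t := X t - f t; pose w' t := H1_deriv X t - H1_deriv u t.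
have Lw : L2 0 1 w.
  by have := L2_lin 1 (-1) LX Lf; congr L2; apply/funext => t; rewrite /w; ring.
have Lw' : L2 0 1 w'.
  by have := L2_lin 1 (-1) LG Lg; congr L2; apply/funext => t; rewrite /w'; ring.
have acw : abs_cont 0 1 w w'.
  have := ac_lin 1 (-1) hX.1 hf.1; congr abs_cont; apply/funext => t; rewrite /w /w'; ring.
have Lr : L2 0 1 (fun t => H1_deriv v t - phi t).
  by have := L2_lin 1 (-1) Lv' Lp; congr L2; apply/funext => t; ring.
rewrite distrC (represents_inner v hX) (represents_inner v hf).
have i1 := L2_mul LX Lv; have i2 := L2_mul Lf Lv.
have i3 := L2_mul LG Lv'; have i4 := L2_mul Lg Lv'.
have i5 := L2_mul Lw Lv; have i6 := L2_mul Lw' Lr; have i7 := L2_mul Lw' Lp.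
have i8 := L2_mul Lw Ldp.
have -> : intg 0 1 (fun t => X t * v t) + intg 0 1 (fun t => H1_deriv X t * H1_deriv v t) -
   (intg 0 1 (fun t => f t * v t) + intg 0 1 (fun t => H1_deriv u t * H1_deriv v t)) =
   intg 0 1 (fun t => w t * v t) + intg 0 1 (fun t => w' t * (H1_deriv v t - phi t)) -
   intg 0 1 (fun t => w t * derive1 phi t).
  rewrite (ac_test acw tphi) opprK.
  have -> : intg 0 1 (fun t => w t * v t) =
      intg 0 1 (fun t => X t * v t) - intg 0 1 (fun t => f t * v t).
    by rewrite -intgB//; apply: eq_intg => t _; rewrite /w; ring.
  have e3 : intg 0 1 (fun t => w' t * (H1_deriv v t - phi t)) +
      intg 0 1 (fun t => w' t * phi t) =
      intg 0 1 (fun t => H1_deriv X t * H1_deriv v t) -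
      intg 0 1 (fun t => H1_deriv u t * H1_deriv v t).
    by rewrite -intgD// -intgB//; apply: eq_intg => t _; rewrite /w'; ring.
  lra.
have b1 (g : R -> R) : L2 0 1 g -> `|intg 0 1 (fun t => w t * g t)| <=
    e / (2 * M) * intg 0 1 (fun t => `|g t|).
  move=> hg; apply: le_trans (intg_norm (L2_mul Lw hg)) _.
  rewrite -intgZ; last by apply: intble_norm; exact: L2_intble.
  apply: le_intg => [||t t01].
  - exact/intble_norm/L2_mul.
  - exact/intbleZ/intble_norm/L2_intble.
  - by rewrite normrM ler_wpM2r// h1.
have b2 : `|intg 0 1 (fun t => w' t * (H1_deriv v t - phi t))| <= e / 2.
  apply: le_trans (intg_norm i6) _.
  apply: (@le_trans _ _ (intg 0 1 (fun t => l / 2 * w' t ^+ 2 +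
     (2 * l)^-1 * (H1_deriv v t - phi t) ^+ 2))).
    apply: le_intg => [||t _]; first exact: intble_norm.
      by apply: intbleD; apply: intbleZ; [case: Lw'|case: Lr].
    rewrite normrM -[w' t ^+ 2]real_normK ?num_real//.
    rewrite -[(_ - phi t) ^+ 2]real_normK ?num_real//.
    set A := `|w' t|; set B := `|_ - _|.
    rewrite -subr_ge0.
    have -> : l / 2 * A ^+ 2 + (2 * l)^-1 * B ^+ 2 - A * B = (2 * l)^-1 * (l * A - B) ^+ 2.
      by field; rewrite gt_eqF.
    by rewrite mulr_ge0 ?sqr_ge0// invr_ge0 mulr_ge0// ltW.
  rewrite intgD ?intgZ; [|by case: Lr|by case: Lw'|
    by apply: intbleZ; case: Lw'|by apply: intbleZ; case: Lr].
  have wD : intg 0 1 (fun t => w' t ^+ 2) <= D.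
    rewrite /D; apply: (@le_trans _ _ (2 * intg 0 1 (fun t => H1_deriv X t ^+ 2) +
       2 * intg 0 1 (fun t => H1_deriv u t ^+ 2))); last by rewrite lerD2r ler_pM2l.
    rewrite -!intgZ -?intgD; [|by apply: intbleZ; case: LG|
      by apply: intbleZ; case: Lg|by case: Lg|by case: LG].
    apply: le_intg => [||t _]; first by case: Lw'.
      by apply: intbleD; apply: intbleZ; [case: LG|case: Lg].
    rewrite /w'; have := sqr_ge0 (H1_deriv X t + H1_deriv u t); lra.
  have s1 : l / 2 * intg 0 1 (fun t => w' t ^+ 2) <= e / 4.
    have lD : l * (`|D| + 1) = e / 2 by rewrite /l; field; rewrite gt_eqF.
    have : l * intg 0 1 (fun t => w' t ^+ 2) <= l * (`|D| + 1).
      by rewrite ler_pM2l//; have := ler_norm D; lra.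
    rewrite lD; lra.
  have s2 : (2 * l)^-1 * intg 0 1 (fun t => (H1_deriv v t - phi t) ^+ 2) <= e / 4.
    rewrite ler_pdivrMl ?mulr_gt0//; apply: le_trans hphi _.
    by rewrite le_eqVlt; apply/orP; left; apply/eqP; field.
  lra.
have c1 := b1 _ Lv; have c2 := b1 _ Ldp.
apply: le_trans (ler_normB _ _) _; apply: le_trans (lerD (ler_normD _ _) (lexx _)) _.
have : e / (2 * M) * (M - 1) <= e / 2.
  have -> : e / 2 = e / (2 * M) * M by field; rewrite gt_eqF.
  by rewrite ler_pM2l//; lra.
have -> : M - 1 = intg 0 1 (fun t => `|v t|) + intg 0 1 (fun t => `|derive1 phi t|).
  by rewrite /M; ring.
rewrite mulrDr; lra.
Unshelve. all: by end_near. Qed.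

(** For each eps take the best precision 1 / (n + 1), with n at most 1/eps, that is
    attained. *)
Lemma diagonal_choice (X : Type) (x0 : X) (P : R -> R -> X -> Prop) :
  (forall d d' eps (x : X), d <= d' -> P d eps x -> P d' eps x) ->
  (forall d, 0 < d -> \forall eps \near (0 : R)^'+, exists x : X, P d eps x) ->
  exists x_ : R -> X, forall d, 0 < d -> \forall eps \near (0 : R)^'+, P d eps (x_ eps).
Proof.
move=> Pmono Pex.
pose dn (n : nat) : R := n.+1%:R^-1.
have dn0 n : 0 < dn n by rewrite invr_gt0.
have : forall eps : R, exists x : X, forall n, (n <= Num.truncn (eps^-1))%N ->
    (exists y : X, P (dn n) eps y) -> P (dn n) eps x.
  move=> eps; pose A n := (n <= Num.truncn (eps^-1))%N &&
    `[< exists y : X, P (dn n) eps y >].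
  have [[n0 An0]|noA] := pselect (exists n, A n); last first.
    by exists x0 => n nN hy; case: noA; exists n; rewrite /A nN; apply/asboolP.
  have bA n : A n -> (n <= Num.truncn (eps^-1))%N by case/andP.
  have exA : exists n, A n by exists n0.
  case: (ex_maxnP exA bA) => m /andP[_ /asboolP[y Py]] hm.
  exists y => n nN hy; apply: Pmono Py.
  rewrite lef_pV2 ?posrE// ler_nat ltnS; apply: hm.
  by rewrite /A nN; apply/asboolP.
move=> /choice[x_ hx]; exists x_ => d d0.
pose n := Num.truncn (d^-1).
have dnd : dn n <= d.
  rewrite -[leRHS]invrK lef_pV2 ?posrE ?invr_gt0//.
  by apply/ltW/truncnS_gt.
have := Pex _ (dn0 n).
have : \forall eps \near (0 : R)^'+, 0 < eps <= dn n.
  near=> eps; apply/andP; split; near: eps; first exact: nbhs_right_gt.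
  exact: nbhs_right_le.
apply: filterS2 => eps /andP[e0 ed] ex; apply: Pmono dnd _; apply: hx => //.
have he : n.+1%:R <= eps^-1.
  by rewrite -[leLHS]invrK lef_pV2 ?posrE ?invr_gt0.
rewrite truncn_ge_nat ?invr_ge0 ?(ltW e0)//.
by apply: le_trans he; rewrite ler_nat.
Unshelve. all: by end_near. Qed.

Lemma limf_esup_le_of_near (h : R -> \bar R) (E : R) :
  (forall d, 0 < d -> \forall e \near (0 : R)^'+, (h e <= (E + d)%:E)%E) ->
  (limf_esup h (0 : R)^'+ <= E%:E)%E.
Proof.
move=> H; apply/lee_addgt0Pr => d d0; rewrite -EFinD.
rewrite limf_esupE; apply: ge_ereal_inf.
exists (ereal_sup (h @` [set e | (h e <= (E + d)%:E)%E])).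
  by exists [set e | (h e <= (E + d)%:E)%E] => //; exact: H.
by apply: ge_ereal_sup => x [e /= he <-].
Qed.

Lemma limf_esup_homo (h k : R -> \bar R) : (forall e, (h e <= k e)%E) ->
  (limf_esup h (0 : R)^'+ <= limf_esup k (0 : R)^'+)%E.
Proof.
move=> hk; rewrite !limf_esupE; apply: le_ereal_inf_tmp => _ [A FA <-].
apply: ge_ereal_inf; exists (ereal_sup (h @` A)); first by exists A.
apply: ge_ereal_sup => x [e Ae <-].
by apply: le_trans (hk e) _; apply: ereal_sup_ubound; exists e.
Qed.

End Limsup.

(** * The recovery sequence *)

Section RecoverySequence.
Context {R : realType}.
Implicit Types (a b c d e r s t x y eps k rho : R).
Implicit Types (f g h w phi : R -> R) (u v : H1 R).
Local Notation mu := (@lebesgue_measure R).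
Variables (V W : R -> R).
Hypotheses (cV : continuous V) (pV : forall s, V (s + 1) = V s)
  (mW : measurable_fun [set: R] W) (W0 : forall s, 0 <= W s) (hW : mean_zero W).

(** Cells shorter than the modulus of continuity of f keep the path within rho of f;
    choosing the constants c cell by cell makes the energies sum to a dual sum. *)
Lemma mesh_transition f rho d : (exists g, abs_cont 0 1 f g) -> 0 < rho -> 0 < d ->
  exists N (c : nat -> R), [/\ (0 < N)%N, forall i s, 0 < V s + c i &
    \forall eps \near (0 : R)^'+,
      transition V W eps 0 1 (f 0) (f 1) f rho (dual_sum V N c f + d)].
Proof.
move=> [g hf] rho0 d0.
have [m m0 hm] := ac_ucont hf (divr_gt0 rho0 (ltr0Sn R 3)).
pose N := (Num.truncn (m^-1)).+1.
have NR : 0 < N%:R :> R by rewrite ltr0n.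
have Nm : N%:R^-1 <= m.
  rewrite -[leRHS]invrK lef_pV2 ?posrE ?invr_gt0//.
  by apply/ltW/truncnS_gt.
pose t_ (i : nat) : R := i%:R / N%:R.
have t01 i : (i <= N)%N -> 0 <= t_ i <= 1.
  by move=> iN; rewrite divr_ge0//= ler_pdivrMr// mul1r ler_nat.
have ts i : t_ i.+1 - t_ i = N%:R^-1.
  by rewrite /t_ -mulrBl -natrB// subSnn mul1r.
have tlt i : t_ i < t_ i.+1 by rewrite -subr_gt0 ts invr_gt0.
have dN : 0 < d / N%:R by rewrite divr_gt0.
have [K K0 hK] := periodic_bounded cV pV.
have : forall i, exists c, (forall s, 0 < V s + c) /\ ((i < N)%N ->
    \forall eps \near (0 : R)^'+, transition V W eps (t_ i) (t_ i.+1)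
      (f (t_ i)) (f (t_ i.+1)) f rho
      (2 * (level_speed V c * `|f (t_ i.+1) - f (t_ i)|) - c * (t_ i.+1 - t_ i) + d / N%:R)).
  move=> i; have [iN|iN] := boolP (i < N)%N; last first.
    exists (K + 1); split => // s.
    by have /ler_normlP[h1 _] := hK s; lra.
  have /andP[a0 a1] := t01 i (ltnW iN); have /andP[b0 b1] := t01 i.+1 iN.
  have close x : t_ i <= x <= t_ i.+1 -> `|f x - f (t_ i)| <= rho / 4.
    move=> /andP[x0 x1]; apply: hm; [apply/andP; split; lra|by rewrite a0|].
    rewrite ger0_norm ?subr_ge0//; apply: le_trans Nm.
    by rewrite -(ts i) lerD2r.
  have [|c [Vc hc]] := @transition_exists R V W cV pV mW W0 hW (t_ i) (t_ i.+1) (f (t_ i))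
      (f (t_ i.+1)) (d / N%:R) f rho (tlt i) dN rho0.
    move=> x xi; have := close _ xi.
    have : `|f (t_ i.+1) - f (t_ i)| <= rho / 4 by apply: close; rewrite lexx ltW.
    lra.
  by exists c; split.
move=> /choice[c hc]; exists N, c; split => // [i s|]; first by case: (hc i).
have H (k : nat) : (k <= N)%N -> \forall eps \near (0 : R)^'+,
    transition V W eps 0 (t_ k) (f 0) (f (t_ k)) f rho
      (\sum_(i < k) (2 * (level_speed V (c i) * `|f (t_ i.+1) - f (t_ i)|)
         - c i / N%:R + d / N%:R)).
  elim: k => [|k IH] kN.
    rewrite /t_ mul0r big_ord0; apply: nearW => eps.
    by apply: transition_point => //; exact: ltW.
  have := IH (ltnW kN); have := (hc k).2 kN; rewrite ts.
  apply: filterS2 => eps h2 h1; rewrite big_ord_recr /=.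
  apply: transition_concat h1 h2 => //.
  by rewrite (ltW (tlt k)) andbT; have /andP[] := t01 k (ltnW kN).
have tN : t_ N = 1 by rewrite /t_ divff// gt_eqF.
have := H N (leqnn N); rewrite tN.
apply: filterS => eps; apply: transition_weaken => [x _|].
  by rewrite subrr normr0 add0r.
rewrite big_split /= /dual_sum lerD2l sumr_const card_ord.
by rewrite -(mulr_natr (d / _)) divfK ?gt_eqF.
Qed.

Lemma recovery_approximation u f d : represents f u -> 0 < d ->
  \forall eps \near (0 : R)^'+, exists x : H1 R,
    [/\ represents x x, forall t, 0 <= t <= 1 -> `|x t - f t| <= d &
        (G_energy V W eps x <= Gamma_energy V u + d%:E)%E].
Proof.
move=> hf d0; have [|N [c [N0 Vc]]] := @mesh_transition f d d _ d0 d0.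
  by exists (H1_deriv u); case: hf.
apply: filterS => eps [F [G [hF [K GK] [_ [_ Ff]] iW en]]].
have LG := L2_bounded_ac hF GK.
have [x xF xG] := H1_of_ac hF LG.
have hx : represents x x.
  by apply: represents_refl xG; rewrite xF.
exists x; split => //; first by rewrite xF.
have iden := transition_density cV pV hF GK iW.
have -> : G_energy V W eps x =
    (intg 0 1 (fun t => G t ^+ 2 + V (F t / eps) + W (F t / eps)))%:E.
  rewrite /G_energy xF xG -intgE// omega_integral.
    by apply: eq_integral => t _; rewrite real_normK ?num_real.
  apply: intble_meas; apply: eq_intble iden => t _.
  by rewrite real_normK ?num_real.
apply: (@le_trans _ _ (dual_sum V N c f + d)%:E); first by rewrite lee_fin.
rewrite EFinD leeD2r//; apply: ereal_sup_ubound; exists N, c, f; split => //.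
Qed.

(** A single cell and a single constant already give a finite lower bound. *)
Lemma Gamma_energy_gtNy u : (-oo < Gamma_energy V u)%E.
Proof.
have [f h1 h2] := H1_representative u.
have [K K0 hK] := periodic_bounded cV pV.
apply: lt_le_trans (ltNyr (dual_sum V 1 (fun=> K + 1) f)) _.
apply: ereal_sup_ubound; exists 1%N, (fun=> K + 1), f; split => // _ s.
by have /ler_normlP[? _] := hK s; lra.
Qed.

Lemma weakly_cvg_cst u : weakly_cvg (fun=> u) u.
Proof. by move=> v; exact: cvg_cst. Qed.

(** If the limit energy is infinite any weakly convergent family will do. Otherwise
    the energy bounds the derivatives in mean square, as V is bounded. *)
Lemma G_energy_limsup u : exists x_ : R -> H1 R, weakly_cvg x_ u /\
  (limf_esup (fun eps => G_energy V W eps (x_ eps)) (0 : R)^'+ <= Gamma_energy V u)%E.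
Proof.
have [f h1 h2] := H1_representative u; have hf : represents f u by [].
have := @recovery_approximation u f ^~ hf.
have [K K0 hK] := periodic_bounded cV pV.
have := Gamma_energy_gtNy u.
case: (Gamma_energy V u) => [E _ happ|_ _|]; last by [].
  pose P d eps (x : H1 R) := [/\ represents x x,
    forall t, 0 <= t <= 1 -> `|x t - f t| <= d &
    (G_energy V W eps x <= (E + d)%:E)%E].
  have [||x_ hx] := @diagonal_choice R (H1 R) u P.
  - move=> d d' eps x dd' [h3 h4 h5]; split => //.
      by move=> t t01; apply: le_trans dd'; exact: h4.
    by apply: le_trans h5 _; rewrite lee_fin lerD2l.
  - by move=> d d0; apply: happ.
  exists x_; split.
    apply: (@weakly_cvg_of_uniform R x_ u f (E + 1 + K) hf).
    - by have := hx 1 ltr01; apply: filterS => eps [].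
    - by move=> d d0; have := hx d d0; apply: filterS => eps [].
    - have := hx 1 ltr01; apply: filterS => eps [h3 _ h5].
      have := le_trans (F_energy_le_G_energy eps (x_ eps) cV pV mW W0) h5.
      rewrite (F_energy_intg eps cV pV h3) lee_fin => h6.
      have LG := H1_deriv_in_L2 (x_ eps).
      have i := energy_density_intble eps cV pV h3.1 LG.
      rewrite -lerBlDr; apply: le_trans h6.
      rewrite -[X in _ - X](intg01_cst K) -intgB; [|by case: LG|exact: intble_cst].
      apply: le_intg => [|//|t _].
        by apply: intbleB; [case: LG|exact: intble_cst].
      by have /ler_normlP[? _] := hK (x_ eps t / eps); lra.
  apply: limf_esup_le_of_near => d d0; have := hx d d0.
  by apply: filterS => eps [].
exists (fun=> u); split; first exact: weakly_cvg_cst.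
by rewrite leey.
Qed.

End RecoverySequence.

Theorem theorem2p4 (R : realType) (V W : R -> R)
  (V_continuous : continuous V)
  (V_periodic : forall s : R, V (s + 1) = V s)
  (W_borel : measurable_fun [set: R] W)
  (W_ge0 : forall s : R, 0 <= W s)
  (W_mean0 :
     ((r^-1)%:E * \int[lebesgue_measure]_(s in `[(- r)%R, r]) (W s)%:E)%E
       @[r --> +oo%R] --> 0%E) :
  exists E : H1 R -> \bar R,
    is_Gamma_limit (F_energy V) E /\ is_Gamma_limit (G_energy V W) E.
Proof.
have FG := fun eps u => @F_energy_le_G_energy R V W eps u
  V_continuous V_periodic W_borel W_ge0.
exists (Gamma_energy V); split; split.
- by move=> u u_ wc; exact: F_energy_liminf.
- move=> u; have [x_ [wc hx]] := G_energy_limsup V_continuous V_periodic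
    W_borel W_ge0 W_mean0 u.
  exists x_; split => //.
  exact: le_trans (limf_esup_homo (fun eps => FG eps (x_ eps))) hx.
- move=> u u_ wc; apply: le_trans (F_energy_liminf V_continuous V_periodic wc) _.
  exact: limf_einf_homo (fun eps => FG eps (u_ eps)).
- by move=> u; exact: G_energy_limsup.
Qed.
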